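(* Let $n\ge 3$ and let $K$ be a field. For every $t=0,1,\ldots,n-2$, the algebra $K_0[M_t]$ is prime.
   Context: For $n\ge 3$, $C_n$ is the monoid generated by $x_1,\dots,x_n$ with relations (indices modulo $n$) $x_i^2=x_i$; $x_ix_j=x_jx_i$ if $i,j$ are distinct and not cyclically adjacent; $x_ix_{i+1}x_i=x_{i+1}x_ix_{i+1}=x_ix_{i+1}$. Let $F$ be the free monoid on $x_1,\dots,x_n$ with the deg-lex order induced by $x_1<\cdots<x_n$. Each element of $C_n$ is identified with its reduced form, i.e. the deg-lex smallest word in $F$ representing it. A word $u$ is a factor of $v$ if $v=v_1uv_2$ in $F$. For $0\le i\le n-2$ let $q_i=x_1\cdots x_i\,x_{n-1}x_{n-2}\cdots x_{i+1}$ (increasing part, then decreasing part; $q_0=x_{n-1}\cdots x_1$). Let $\tilde M_i$ be the set of elements of $C_n$ whose reduced form has a factor $x_nq_i$. Let $I_i=\{w\in C_n: C_nwC_n\cap\langle x_nq_i\rangle=\emptyset\}$, where $\langle x_nq_i\rangle$ is the submonoid generated by $x_nq_i$; $I_i$ is empty or an ideal of $C_n$ (and $I_{n-2}=\emptyset$), and $\tilde M_i\cap I_i=\emptyset$. Let $M_i=\tilde M_i\cup\{\theta\}$, with $\theta$ a zero element and with the product of $u,w\in\tilde M_i$ equal to their product $uw$ in $C_n$ if $uw\notin I_i$ (in which case $uw\in\tilde M_i$) and equal to $\theta$ if $uw\in I_i$; this is a semigroup. For a semigroup $M$ with zero $\theta$, the contracted semigroup algebra is $K_0[M]=K[M]/K\theta$.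 An algebra (not necessarily with unity) is prime if the product of any two nonzero ideals is nonzero. *)

(* Defs.v *)
From HB Require Import structures.
From mathcomp Require Import all_boot all_order all_algebra finmap zify.
From mathcomp Require Import boolp.
From mathcomp.multinomials Require Import monalg.

Set Implicit Arguments.
Unset Strict Implicit.
Unset Printing Implicit Defensive.

Import Order.TTheory GRing.Theory.
Local Open Scope ring_scope.
Local Open Scope quotient_scope.

(* Prime algebras, without assuming a unity. Ideals are two-sided ideals of   *)
(* the algebra, hence K-subspaces; the product of two ideals is the set of    *)
(* finite sums of products.                                                   *)
Section PrimeAlgebra.
Variables (K : fieldType) (A : lmodType K) (mulA : A -> A -> A).
Implicit Types I J : A -> Prop.

Definition alg_ideal I : Prop :=
  [/\ I 0,
      forall (c : K) (x y : A), I x -> I y -> I (c *: x + y),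
      forall a x : A, I x -> I (mulA a x) &
      forall a x : A, I x -> I (mulA x a)].

Definition ideal_mul I J : A -> Prop := fun x =>
  exists2 s : seq (A * A), (forall p, p \in s -> I p.1 /\ J p.2) &
    x = \sum_(p <- s) mulA p.1 p.2.

Definition nonzero_set I : Prop := exists2 x, I x & x != 0.

Definition prime_algebra : Prop :=
  forall I J, alg_ideal I -> alg_ideal J ->
    nonzero_set I -> nonzero_set J -> nonzero_set (ideal_mul I J).

End PrimeAlgebra.

(* Semigroups with zero; associativity plays no role in the definition of the *)
(* contracted algebra and is not required.                                    *)
HB.mixin Record Magma_hasTheta S of ChoiceMagma S := {
  theta : S;
  mul_theta : forall x : S, (theta * x)%g = theta;
  theta_mul : forall x : S, (x * theta)%g = theta
}.

#[short(type="thetaMagmaType")]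
HB.structure Definition ThetaMagma := {S of Magma_hasTheta S & ChoiceMagma S}.

(* {malg K[S]} is the K-vector space with basis S; the product provided by    *)
(* the library needs S to have a unit, hence the explicit convolution.        *)
Section SemigroupAlgebra.
Variables (K : fieldType) (S : ChoiceMagma.type).
Implicit Types a b c : {malg K[S]}.
Local Open Scope fset_scope.
Local Open Scope ring_scope.

Definition conv a b : {malg K[S]} :=
  \sum_(u <- msupp a) \sum_(v <- msupp b) << a@_u * b@_v *g (u * v)%g >>.

Lemma convEw (d1 d2 : {fset S}) a b :
  msupp a `<=` d1 -> msupp b `<=` d2 ->
  conv a b =
    \sum_(u <- d1) \sum_(v <- d2) << a@_u * b@_v *g (u * v)%g >>.
Proof.
move=> le1 le2; rewrite /conv (big_fset_incl _ le1) /=.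
  apply/eq_bigr=> u _; apply/big_fset_incl => // v _ /mcoeff_outdom ->.
  by rewrite mulr0 monalgU0.
move=> u _ /mcoeff_outdom au; rewrite big1 // => v _.
by rewrite au mul0r monalgU0.
Qed.

Lemma convU (x y : K) (u v : S) :
  conv << x *g u >> << y *g v >> = << x * y *g (u * v)%g >>.
Proof.
by rewrite (convEw (@msuppU_le _ _ _ _) (@msuppU_le _ _ _ _))
  !big_seq_fset1 !mcoeffUU.
Qed.

Lemma scale_malgU (x y : K) (u : S) : x *: << y *g u >> = << x * y *g u >>.
Proof. by apply/malgP=> k; rewrite mcoeffZ !mcoeffU mulrnAr. Qed.

Lemma conv_linearl c (x : K) a b :
  conv (x *: a + b) c = x *: conv a c + conv b c.
Proof.
have sub : msupp (x *: a + b) `<=` msupp a `|` msupp b.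
  by apply: (fsubset_trans (msuppD_le _ _)); apply: fsetSU; apply: msuppZ_le.
rewrite (convEw sub (fsubset_refl (msupp c))).
rewrite (convEw (fsubsetUl (msupp a) (msupp b)) (fsubset_refl (msupp c))).
rewrite (convEw (fsubsetUr (msupp a) (msupp b)) (fsubset_refl (msupp c))).
rewrite scaler_sumr -big_split; apply/eq_bigr=> u _ /=.
rewrite scaler_sumr -big_split; apply/eq_bigr=> v _ /=.
by rewrite mcoeffD mcoeffZ mulrDl monalgUD scale_malgU mulrA.
Qed.

Lemma conv_linearr c (x : K) a b :
  conv c (x *: a + b) = x *: conv c a + conv c b.
Proof.
have sub : msupp (x *: a + b) `<=` msupp a `|` msupp b.
  by apply: (fsubset_trans (msuppD_le _ _)); apply: fsetSU; apply: msuppZ_le.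
rewrite (convEw (fsubset_refl (msupp c)) sub).
rewrite (convEw (fsubset_refl (msupp c)) (fsubsetUl (msupp a) (msupp b))).
rewrite (convEw (fsubset_refl (msupp c)) (fsubsetUr (msupp a) (msupp b))).
rewrite scaler_sumr -big_split; apply/eq_bigr=> u _ /=.
rewrite scaler_sumr -big_split; apply/eq_bigr=> v _ /=.
by rewrite mcoeffD mcoeffZ mulrDr monalgUD scale_malgU mulrCA.
Qed.

End SemigroupAlgebra.

Section ContractedAlgebra.
Variables (K : fieldType) (S : thetaMagmaType).
Local Notation thetaS := (theta : S).

Definition theta_line : pred {malg K[S]} :=
  fun a => `[< exists c : K, a = c *: << thetaS >> >].

Fact theta_line_closed : zmod_closed theta_line.
Proof.
split=> [|a b]; first by apply/asboolP; exists 0; rewrite scale0r.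
move=> /asboolP[c ->] /asboolP[d ->]; apply/asboolP; exists (c - d).
by rewrite scalerBl.
Qed.
HB.instance Definition _ :=
  GRing.isZmodClosed.Build {malg K[S]} theta_line theta_line_closed.

Definition theta_ideal : zmodClosed {malg K[S]} :=
  GRing.ZmodClosed.clone {malg K[S]} theta_line _.

Definition contracted : Type := Quotient.quot theta_ideal.
HB.instance Definition _ := Choice.on contracted.
HB.instance Definition _ := GRing.Zmodule.on contracted.

Definition cproj (a : {malg K[S]}) : contracted :=
  \pi_(Quotient.quot theta_ideal) a.
Definition crepr (x : contracted) : {malg K[S]} :=
  repr (x : Quotient.quot theta_ideal).

Lemma creprK x : cproj (crepr x) = x.
Proof. exact: reprK. Qed.

Lemma cprojP a b :
  reflect (exists c : K, a = b + c *: << thetaS >>) (cproj a == cproj b).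
Proof.
rewrite /cproj -Quotient.idealrBE.
apply: (iffP (asboolP _)) => -[c]; last by move=> ->; exists c; rewrite addrC addKr.
by move=> e; exists c; rewrite -e addrC subrK.
Qed.

Lemma cprojD a b : cproj (a + b) = cproj a + cproj b.
Proof. exact: (raddfD (\pi_(Quotient.quot theta_ideal))). Qed.

Definition cscale (c : K) (x : contracted) : contracted :=
  cproj (c *: crepr x).

Lemma cscaleE c a : cscale c (cproj a) = cproj (c *: a).
Proof.
have /eqP/cprojP[d e] := creprK (cproj a).
by apply/eqP/cprojP; exists (c * d); rewrite e scalerDr scalerA.
Qed.

Fact cscaleA c d x : cscale c (cscale d x) = cscale (c * d) x.
Proof. by rewrite -[x]creprK !cscaleE scalerA. Qed.
Fact cscale1 : left_id 1 cscale.
Proof. by move=> x; rewrite -[x]creprK cscaleE scale1r. Qed.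
Fact cscaleDr : right_distributive cscale +%R.
Proof.
move=> c x y; rewrite -[x]creprK -[y]creprK -cprojD !cscaleE.
by rewrite scalerDr cprojD.
Qed.
Fact cscaleDl x : {morph cscale^~ x : c d / c + d}.
Proof. by move=> c d; rewrite -[x]creprK !cscaleE scalerDl cprojD. Qed.

HB.instance Definition _ := GRing.Zmodule_isLmodule.Build K contracted
  cscaleA cscale1 cscaleDr cscaleDl.

Definition cmul (x y : contracted) : contracted :=
  cproj (conv (crepr x) (crepr y)).

Lemma conv_theta a :
  (exists c : K, conv a << thetaS >> = c *: << thetaS >>) /\
  (exists c : K, conv << thetaS >> a = c *: << thetaS >>).
Proof.
split.
- exists (\sum_(u <- msupp a) a@_u).
  rewrite (convEw (fsubset_refl (msupp a)) (@msuppU_le _ _ _ _)) scaler_suml.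
  apply/eq_bigr=> u _; rewrite big_seq_fset1 mcoeffUU theta_mul.
  by rewrite scale_malgU.
- exists (\sum_(u <- msupp a) a@_u).
  rewrite (convEw (@msuppU_le _ _ _ _) (fsubset_refl (msupp a))) scaler_suml.
  rewrite big_seq_fset1; apply/eq_bigr=> u _; rewrite mcoeffUU mul_theta.
  by rewrite scale_malgU mul1r mulr1.
Qed.

Lemma cmulE a b : cmul (cproj a) (cproj b) = cproj (conv a b).
Proof.
have /eqP/cprojP[c ea] := creprK (cproj a).
have /eqP/cprojP[d eb] := creprK (cproj b).
have [c1 e1] := (conv_theta a).1.
have [c2 e2] := (conv_theta (crepr (cproj b))).2.
apply/eqP/cprojP; exists (c * c2 + d * c1).
rewrite {1}ea [a + _]addrC conv_linearl e2 eb [b + _]addrC conv_linearr e1.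
by rewrite !scalerA addrA -scalerDl addrC.
Qed.

Lemma cprojZ (c : K) a : cproj (c *: a) = c *: cproj a.
Proof. by rewrite -cscaleE. Qed.

Lemma cmul_linearl z (c : K) x y :
  cmul (c *: x + y) z = c *: cmul x z + cmul y z.
Proof.
rewrite -[x]creprK -[y]creprK -[z]creprK -cprojZ -cprojD !cmulE.
by rewrite conv_linearl cprojD cprojZ.
Qed.

Lemma cmul_linearr z (c : K) x y :
  cmul z (c *: x + y) = c *: cmul z x + cmul z y.
Proof.
rewrite -[x]creprK -[y]creprK -[z]creprK -cprojZ -cprojD !cmulE.
by rewrite conv_linearr cprojD cprojZ.
Qed.

End ContractedAlgebra.

(* The monoid C_n. The letter x_k is the element of 'I_n with value k - 1, so *)
(* that ordS is the successor of indices modulo n.                            *)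
Section CycleMonoid.
Variable n : nat.
Implicit Types u v w : seq 'I_n.

Inductive crel : seq 'I_n -> seq 'I_n -> Prop :=
| crel_idem i : crel [:: i; i] [:: i]
| crel_comm i j : i != j -> j != ordS i -> i != ordS j ->
    crel [:: i; j] [:: j; i]
| crel_braidl i : crel [:: i; ordS i; i] [:: i; ordS i]
| crel_braidr i : crel [:: ordS i; i; ordS i] [:: i; ordS i].

Inductive ccong : seq 'I_n -> seq 'I_n -> Prop :=
| ccong_rel u v : crel u v -> ccong u v
| ccong_refl u : ccong u u
| ccong_sym u v : ccong u v -> ccong v u
| ccong_trans u v w : ccong u v -> ccong v w -> ccong u w
| ccong_cat u u' v v' : ccong u u' -> ccong v v' -> ccong (u ++ v) (u' ++ v').

Definition cequiv u v : bool := `[< ccong u v >].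

Fact cequiv_class : equiv_class_of cequiv.
Proof.
split=> [u | u v | v u w].
- exact/asboolP/ccong_refl.
- by apply/asboolP/asboolP => /ccong_sym.
- by move=> /asboolP uv /asboolP vw; apply/asboolP; apply: ccong_trans vw.
Qed.
Canonical cequiv_equiv := EquivRelPack cequiv_class.

Definition Cmon : Type := {eq_quot cequiv}.
HB.instance Definition _ := Choice.on Cmon.

Definition cls w : Cmon := \pi_({eq_quot cequiv}) w.

Lemma clsP u v : cls u = cls v <-> ccong u v.
Proof.
split=> [e|uv]; last by apply/eqmodP/asboolP.
by apply/asboolP; have /eqmodP := e.
Qed.

Definition crep (x : Cmon) : seq 'I_n := repr (x : {eq_quot cequiv}).

Lemma crepK x : cls (crep x) = x.
Proof. exact: reprK. Qed.

Definition Cmul (x y : Cmon) : Cmon := cls (crep x ++ crep y).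

Lemma CmulE u v : Cmul (cls u) (cls v) = cls (u ++ v).
Proof. by apply/clsP/ccong_cat; apply/clsP/crepK. Qed.

Fact CmulA : associative Cmul.
Proof.
by move=> x y z; rewrite -[x]crepK -[y]crepK -[z]crepK !CmulE catA.
Qed.
Fact Cmul1 : left_id (cls [::]) Cmul.
Proof. by move=> x; rewrite -[x]crepK CmulE. Qed.
Fact C1mul : right_id (cls [::]) Cmul.
Proof. by move=> x; rewrite -[x]crepK CmulE cats0. Qed.

HB.instance Definition _ := isMonoid.Build Cmon CmulA Cmul1 C1mul.

Definition deglex u v : bool :=
  (size u < size v)%N ||
  (size u == size v) && ((u : seqlexi 'I_n) <= (v : seqlexi 'I_n))%O.

Definition reduced_form (x : Cmon) w : Prop :=
  cls w = x /\ forall v, cls v = x -> deglex w v.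

Lemma reduced_form_uniq x w1 w2 :
  reduced_form x w1 -> reduced_form x w2 -> w1 = w2.
Proof.
move=> [e1 m1] [e2 m2]; move: (m1 _ e2) (m2 _ e1); rewrite /deglex.
case: ltngtP => //= _ le12 le21; apply/(@le_anti _ (seqlexi 'I_n)).
by rewrite le12.
Qed.

Lemma reduced_form_ex x : exists w, reduced_form x w.
Proof.
pose P m := `[< exists2 w, cls w = x & size w = m >].
have exP : exists m, P m.
  by exists (size (crep x)); apply/asboolP; exists (crep x); rewrite ?crepK.
case: (ex_minnP exP) => m /asboolP[w0 xw0 sz0] min_m.
pose Q (s : m.-tuple 'I_n) := `[< cls s = x >].
pose F (s : m.-tuple 'I_n) : seqlexi 'I_n := val s.
have sz : size w0 == m by apply/eqP.
have Q0 : Q (Tuple sz) by apply/asboolP.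
case: (arg_minP F Q0) => s /asboolP xs min_s.
exists s; split=> // v xv; rewrite /deglex size_tuple.
have : (m <= size v)%N by apply: min_m; apply/asboolP; exists v.
rewrite leq_eqVlt => /orP[mv|->//]; rewrite mv /= orbC.
have szv : size v == m by rewrite eq_sym.
by rewrite (min_s (Tuple szv)) //; apply/asboolP.
Qed.

End CycleMonoid.

(* Words are given by the 1-based indices of their letters. All indices used  *)
(* below lie between 1 and n as soon as 0 < n and t < n, see word_xq.         *)
Definition word (n : nat) (s : seq nat) : seq 'I_n :=
  pmap (fun k => insub k.-1) s.

Definition q (n t : nat) : seq nat :=
  iota 1 t ++ rev (iota t.+1 (n.-1 - t)).

Definition xq (n t : nat) : seq 'I_n := word n (n :: q n t).

Lemma word_xq n t : (t < n)%N ->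
  [seq (val i).+1 | i <- xq n t] = n :: q n t.
Proof.
move=> tn; have all_ok : all (fun k => (0 < k <= n)%N) (n :: q n t).
  apply/allP=> k; rewrite inE mem_cat mem_rev !mem_iota; lia.
rewrite /xq /word; elim: (n :: q n t) all_ok => //= k s IH /andP[hk hs].
have kn : (k.-1 < n)%N by lia.
by rewrite (insubT (fun m => m < n)%N kn) /= IH // prednK //; lia.
Qed.

Section Mt.
Variables n t : nat.
Local Open Scope group_scope.

Definition gen : Cmon n := cls (xq n t).

Definition Mtilde : pred (Cmon n) := fun x =>
  `[< exists2 w, reduced_form x w & infix (xq n t) w >].

Definition gen_submonoid (x : Cmon n) : Prop := exists k : nat, x = gen ^+ k.

Definition Iset (x : Cmon n) : Prop :=
  forall a b : Cmon n, ~ gen_submonoid (a * x * b).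

Definition Mt : Type := option {x : Cmon n | Mtilde x}.
HB.instance Definition _ := Choice.on Mt.

(* None is the zero. When u * v is not in Iset, it is in Mtilde, so that insub *)
(* returns Some (u * v): the default case of insub does not occur.            *)
Definition Mt_mul (x y : Mt) : Mt :=
  match x, y with
  | Some u, Some v =>
      if `[< Iset (val u * val v) >] then None else insub (val u * val v)
  | _, _ => None
  end.

HB.instance Definition _ := hasMul.Build Mt Mt_mul.

Fact Mt_mul_theta (x : Mt) : (None : Mt) * x = None.
Proof. by []. Qed.
Fact Mt_theta_mul (x : Mt) : x * (None : Mt) = None.
Proof. by case: x. Qed.

HB.instance Definition _ :=
  Magma_hasTheta.Build Mt Mt_mul_theta Mt_theta_mul.

End Mt.

(* Main.v *)
Require Import Defs.
From mathcomp Require Import all_boot all_order all_algebra perm finmap zify.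
From mathcomp Require Import boolp.
From mathcomp.multinomials Require Import monalg.

Set Implicit Arguments.
Unset Strict Implicit.
Unset Printing Implicit Defensive.

Import Order.TTheory.

(** The monoid acts faithfully on positions. Put a token on every integer, and
    let the letter [i] move all tokens at positions congruent to [i] modulo [n]
    one step to the right, where they merge with the tokens already there. Each
    element becomes a monotone map [f] with [f (p + n) = f p + n] and
    [p <= f p], and conversely every such map arises as soon as it is the
    identity or has [f p = f p.+1] for some [p] ([act_surj]). A word of minimal
    length is a history of an exclusion process: each of its letters moves one
    particle from an occupied site of the cycle to an empty one
    ([minlen_exclusion]). The map shows which sites are occupied at the start,
    which allows one to peel off letters one by one; so the map determines the
    element ([minlen_faithful]).

    The rank of a map is the number of residues modulo [n] that it attains, and
    it is the number of particles of the process. Reading the letters of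
    [x_n q_t], each of which occurs once, reveals which sites are occupied at
    that moment: there are [n - 1 - t] particles. So every element of [Mtilde]
    has rank [n - 1 - t] ([Mtilde_rank]). Conversely the reduced form, being the
    lexicographically least history, always moves the free particle of least
    index. When the particles have far to go, the first move across the end of
    the cycle finds them packed on the last sites, and the next [n] moves spell
    [x_n q_t]. So every large element of rank [n - 1 - t] lies in [Mtilde]
    ([Mtilde_large]); and no element of this rank lies in [Iset]
    ([rank_notin_Iset]).

    Primeness follows from a unique product argument. Given the supports of two
    nonzero elements of the algebra, let [f0] and [g0] be elements of the two
    supports for which the sum of the values on a period is least. There is a
    large [s] whose blocks (maximal intervals on which it is constant) have the
    points of the image of [f0] as right ends, and whose image consists of right
    ends of blocks of [g0] ([connecting_word]). If [f s g = f0 s g0] with [f],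
    [g] in the supports, then [f = f0] and [g = g0] ([connected_cancel]). Hence
    [f0 s g0] has a nonzero coefficient in the product of the two algebra
    elements with [s] in between, and it is not [theta] because it is large and
    of full rank. *)

(** * Monotone periodic maps *)

Section CycleMonoid.
Variable n : nat.
Hypothesis n_gt2 : 2 < n.
Let n_gt0 : 0 < n. Proof. exact: ltn_trans n_gt2. Qed.

Implicit Types (f g h s : nat -> nat) (i j : 'I_n) (u v w : seq 'I_n).

(** A monotone inflationary map of the integers that commutes with the shift
    by [n] is determined by its values on the natural numbers. *)
Definition cyclic f : Prop :=
  [/\ {homo f : p q / p <= q}, forall p, f (p + n) = f p + n &
      forall p, p <= f p].

Lemma cyclicDM f k p : cyclic f -> f (p + k * n) = f p + k * n.
Proof.
by case=> _ fD _; elim: k => [|k IH]; rewrite ?addn0 // mulSnr !addnA fD IH.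
Qed.

Lemma cyclic_congr f p q : cyclic f -> p = q %[mod n] -> f p + q = f q + p.
Proof.
move=> cf; wlog le_qp : p q / q <= p => [H|] /eqP.
  case: (leqP q p) => [|/ltnW] le /eqP e; first exact: H.
  by apply/esym/H.
rewrite eqn_mod_dvd // => /dvdnP[k e].
by rewrite -(subnKC le_qp) e cyclicDM //; lia.
Qed.

Lemma cyclic_ind (P : nat -> Prop) :
  (forall p, P p -> P (p + n)) -> (forall p, p < n -> P p) -> forall p, P p.
Proof.
move=> PD P0 p; rewrite (divn_eq p n) addnC.
elim: (p %/ n) => [|k IH]; first by rewrite addn0; apply/P0/ltn_pmod.
by rewrite mulSnr addnA; apply: PD.
Qed.

Lemma cyclic_ext f g : cyclic f -> cyclic g ->
  (forall p, p < n -> f p = g p) -> f =1 g.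
Proof.
move=> [_ fD _] [_ gD _] e; apply: cyclic_ind => // p ep.
by rewrite fD gD ep.
Qed.

Lemma cyclic_comp f g : cyclic f -> cyclic g -> cyclic (fun p => g (f p)).
Proof.
move=> [fm fD fi] [gm gD gi]; split=> [p q le|p|p].
- by apply/gm/fm.
- by rewrite fD gD.
- exact: leq_trans (fi p) (gi _).
Qed.

Lemma strict_slope f p k :
  (forall p, f p < f p.+1) -> f p + k <= f (p + k).
Proof.
by move=> fS; elim: k => [|k IH]; rewrite ?addn0 // !addnS; have := fS (p + k); lia.
Qed.

(** Each step rises by at least one and [n] steps rise by exactly [n]. *)
Lemma strict_shift f p : cyclic f -> (forall p, f p < f p.+1) -> f p = f 0 + p.
Proof.
move=> cf fS; have := strict_slope 0 p fS; rewrite add0n.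
have := strict_slope p (p * n - p) fS; rewrite subnKC ?leq_pmulr //.
by have := cyclicDM p 0 cf; rewrite add0n => ->; have := leq_pmulr p n_gt0; lia.
Qed.

(** A period of [n] steps rises by [n], so a step of height zero is made up
    for by a step of height two or more. *)
Lemma nonjump_gap f p0 : cyclic f -> f p0 = f p0.+1 ->
  exists p, (f p).+1 < f p.+1.
Proof.
move=> cf fp0; apply: contrapT => nex.
have step p : f p.+1 <= (f p).+1.
  by rewrite leqNgt; apply/negP => lt; apply: nex; exists p.
have slope k : f (p0.+1 + k) <= f p0.+1 + k.
  by elim: k => [|k IH]; rewrite ?addn0 // !addnS; have := step (p0.+1 + k); lia.
have := slope n.-1; rewrite addSnnS prednK //; case: cf => _ -> _; lia.
Qed.

(** The jumps are the right ends of the blocks of [f], the maximal intervals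
    on which [f] is constant; so [jumps f p] numbers the block of [p]. *)
Definition jumps f p : nat := \sum_(0 <= q < p) (f q < f q.+1).

Lemma jumpsS f p : jumps f p.+1 = jumps f p + (f p < f p.+1).
Proof. exact: big_nat_recr. Qed.

Lemma jumps0 f : jumps f 0 = 0.
Proof. exact: big_geq. Qed.

Lemma jumps_le f p q : p <= q -> jumps f p <= jumps f q.
Proof.
move=> /subnKC<-; elim: (q - p) => [|k IH]; rewrite ?addn0 // addnS jumpsS; lia.
Qed.

Lemma jumpsD f p : cyclic f -> jumps f (p + n) = jumps f p + jumps f n.
Proof.
case=> _ fD _; elim: p => [|p IH]; first by rewrite jumps0.
by rewrite addSn !jumpsS IH -addSn !fD ltn_add2r; lia.
Qed.

Lemma jumpsDM f k p : cyclic f ->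
  jumps f (p + k * n) = jumps f p + k * jumps f n.
Proof.
move=> cf; elim: k => [|k IH]; rewrite ?addn0 // mulSnr addnA jumpsD // IH; lia.
Qed.

Lemma jumps_lt f p q : {homo f : p q / p <= q} ->
  (jumps f p < jumps f q) = (f p < f q).
Proof.
move=> fm; case: (leqP q p) => [le|/ltnW le].
  by have := fm _ _ le; have := jumps_le f le; lia.
move: le => /subnKC<-; elim: (q - p) => [|k IH]; first by rewrite addn0; lia.
rewrite addnS jumpsS; have := fm _ _ (leqnSn (p + k)).
have := fm _ _ (leq_addr k p); have := jumps_le f (leq_addr k p); lia.
Qed.

Lemma jumps_slow f A p : {homo A : p q / p <= q} ->
  (forall p, f p < f p.+1 -> A p < A p.+1) -> jumps f p + A 0 <= A p.
Proof.
move=> Am AS; elim: p => [|p IH]; first by rewrite jumps0.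
by rewrite jumpsS; have := AS p; have := Am _ _ (leqnSn p); lia.
Qed.

(** In a period [A] rises by the number of jumps of [f], and it rises at each
    of them: so it rises by exactly one there, and nowhere else. *)
Lemma jumps_index f A p : cyclic f -> {homo A : p q / p <= q} ->
    (forall p, A (p + n) = A p + jumps f n) ->
    (forall p, f p < f p.+1 -> A p < A p.+1) ->
  A p = A 0 + jumps f p.
Proof.
move=> cf Am AD AS; have := jumps_slow p Am AS.
have ADM k : A (k * n) = A 0 + k * jumps f n.
  by elim: k => [|k IH]; rewrite ?mul0n ?addn0 // mulSnr AD IH; lia.
have slow k : jumps f (p + k) + A p <= A (p + k) + jumps f p.
  elim: k => [|k IH]; first by rewrite addn0 addnC.
  by rewrite addnS jumpsS; have := AS (p + k); have := Am _ _ (leqnSn (p + k)); lia.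
have := slow (p * n - p); rewrite subnKC ?leq_pmulr // ADM.
by have := jumpsDM p 0 cf; rewrite jumps0 !add0n => ->; lia.
Qed.

Lemma jump_ex f : cyclic f -> exists p, f p < f p.+1.
Proof.
move=> cf; apply: contrapT => nex.
have : f n <= f 0.
  elim: (n) => // m; apply: leq_trans; rewrite leqNgt; apply/negP => lt.
  by apply: nex; exists m.
by case: cf => _ fD _; rewrite -[n in f n]add0n fD; lia.
Qed.

Lemma jumps_gt0 f : cyclic f -> 0 < jumps f n.
Proof.
move=> cf; have [p0 jp0] := jump_ex cf.
have : 0 < jumps f (p0.+1 * n).
  apply: leq_trans (jumps_le f (leq_pmulr p0.+1 n_gt0)).
  by rewrite jumpsS jp0 addn1.
have := jumpsDM p0.+1 0 cf; rewrite add0n jumps0 add0n => ->.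
by rewrite muln_gt0 => /andP[].
Qed.

Lemma jump_at f k : cyclic f -> exists2 x, f x < f x.+1 & jumps f x = k.
Proof.
move=> cf; have J_gt0 := jumps_gt0 cf.
have ex : exists x, k < jumps f x.+1.
  exists (k.+1 * n); apply: leq_trans (jumps_le f (leqnSn _)).
  by have := jumpsDM k.+1 0 cf; rewrite add0n jumps0 => ->; nia.
case: (ex_minnP ex) => x kx min_x.
have xk : jumps f x <= k.
  case: x min_x {kx} => [|x] min_x; first by rewrite jumps0.
  by rewrite leqNgt; apply/negP => /min_x; lia.
by exists x; move: kx; rewrite jumpsS; case: (f x < f x.+1); lia.
Qed.

(** * Words acting on positions *)

(** Words act from the right, their first letter first. The letter [i] merges
    the tokens at [p] with those at [p.+1] for all [p] congruent to [i]. *)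
Definition act1 i p : nat := if p %% n == i then p.+1 else p.

Definition act w p : nat := foldl (fun p i => act1 i p) p w.

Lemma act_cat u v p : act (u ++ v) p = act v (act u p).
Proof. exact: foldl_cat. Qed.

Lemma modnS_n p : p.+1 %% n = if (p %% n).+1 == n then 0 else (p %% n).+1.
Proof.
rewrite -addn1 -modnDml addn1; case: eqP => [->|ne]; first exact: modnn.
by rewrite modn_small //; have := ltn_pmod p n_gt0; lia.
Qed.

Lemma ordS_mod i p : (p.+1 %% n == ordS i) = (p %% n == i).
Proof.
rewrite /= !modnS_n (modn_small (ltn_ord i)).
have := ltn_ord i; have := ltn_pmod p n_gt0.
by case: ifP; case: ifP; lia.
Qed.

Lemma ordS_val i : ordS i = (if i.+1 == n then 0 else i.+1) :> nat.
Proof. by rewrite /= modnS_n (modn_small (ltn_ord i)). Qed.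

Lemma ord_pred_val i : ord_pred i = (if i == 0 :> nat then n.-1 else i.-1) :> nat.
Proof.
rewrite /=; have := ltn_ord i; case: eqP => [->|/eqP i0] lt_i.
  by rewrite modn_small //; lia.
by rewrite -subn1 addnC -addnBA ?lt0n // modnDl modn_small; lia.
Qed.

Lemma ordS_neq i : ordS i != i.
Proof.
by rewrite -(inj_eq (@ord_inj _)) ordS_val; have := ltn_ord i; case: ifP; lia.
Qed.

Lemma ordSS_neq i : ordS (ordS i) != i.
Proof.
by rewrite -(inj_eq (@ord_inj _)) !ordS_val; have := ltn_ord i; do !case: ifP; lia.
Qed.

Lemma ordS_eq i j : (ordS i == j) = (i == ord_pred j).
Proof. by apply/eqP/eqP => [<-|->]; rewrite ?ordSK ?ord_predK. Qed.

Lemma act1_cyclic i : cyclic (act1 i).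
Proof.
split=> [p q|p|p]; rewrite /act1 ?modnDr; last by case: eqP.
- rewrite leq_eqVlt => /orP[/eqP->//|lt].
  by do 2!case: eqP => _; lia.
- by case: eqP; rewrite ?addSn.
Qed.

Lemma act_cyclic w : cyclic (act w).
Proof.
elim: w => [|i w IH]; first by split.
exact: (cyclic_comp (act1_cyclic i) IH).
Qed.

Lemma act_le_size w p : act w p <= p + size w.
Proof.
elim: w p => [|i w IH] p /=; first by rewrite addn0.
by apply: leq_trans (IH _) _; rewrite /act1; case: eqP; lia.
Qed.

Lemma act_notin w p : (forall i, i \in w -> p %% n != i) -> act w p = p.
Proof.
elim: w => //= i w IH H; rewrite /act1 (negbTE (H i _)) ?mem_head //.
by apply: IH => j jw; apply: H; rewrite inE jw orbT.
Qed.

(** Only the letter congruent to [y] moves a token away from [y]. *)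
Lemma act_barrier i w p y : i \notin w -> y %% n = i -> p <= y -> act w p <= y.
Proof.
elim: w p => //= j w IH p; rewrite inE negb_or => /andP[ij iw] yi py.
apply: IH => //; rewrite /act1; case: eqP => // pj.
rewrite ltn_neqAle py andbT; apply: contraNneq ij => e.
by apply/eqP/ord_inj; rewrite -yi -pj e.
Qed.

Lemma crel_act u v : crel u v -> act u =1 act v.
Proof.
have on i p : p %% n == i -> act1 i p = p.+1 by rewrite /act1 => ->.
have off i p : p %% n != i -> act1 i p = p by rewrite /act1 => /negbTE->.
have other i j p : p %% n == i -> i != j -> act1 j p = p.
  by move=> /eqP pi ij; apply: off; rewrite pi (inj_eq (@ord_inj _)).
have next i p : p %% n == i -> p.+1 %% n == ordS i by rewrite ordS_mod.
case=> {u v} [i|i j ij ji1 ij1|i|i] p; rewrite /act /=.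
- have [pi|pi] := boolP (p %% n == i); last by rewrite !off.
  by rewrite (on i p) // (other (ordS i)) ?next ?ordS_neq.
- have [pi|pi] := boolP (p %% n == i).
    by rewrite (on i p) // (other i j p) // (other (ordS i)) ?next // ?on // eq_sym.
  have [pj|pj] := boolP (p %% n == j); last by rewrite !off.
  by rewrite (off i p) // (on j p) // (other (ordS j)) ?next // eq_sym.
- have [pi|pi] := boolP (p %% n == i).
    rewrite (on i p) // (on (ordS i) p.+1) ?next //.
    by rewrite (other (ordS (ordS i))) ?next ?ordSS_neq.
  have [pj|pj] := boolP (p %% n == ordS i); last by rewrite !off.
  rewrite (off i p) // (on (ordS i) p) //.
  by rewrite (other (ordS (ordS i))) ?next ?ordSS_neq.
- have [pi|pi] := boolP (p %% n == i).
    by rewrite (other i (ordS i) p) // eq_sym ordS_neq.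
  have [pj|pj] := boolP (p %% n == ordS i); last by rewrite !off.
  rewrite (on (ordS i) p) // (other (ordS (ordS i)) i p.+1) ?next ?ordSS_neq //.
  rewrite (other (ordS (ordS i)) (ordS i) p.+1) ?next ?ordS_neq //.
  by rewrite (other (ordS i) i p) ?ordS_neq // (on (ordS i) p).
Qed.

Lemma ccong_act u v : ccong u v -> act u =1 act v.
Proof.
elim=> {u v} [u v /crel_act//|//|u v _ IH p|u v w _ IH1 _ IH2 p|].
- by rewrite IH.
- by rewrite IH1.
- by move=> u u' v v' _ IH1 _ IH2 p; rewrite !act_cat IH1 IH2.
Qed.

(** ** Words of minimal length *)

Lemma ccong_letters i j : j != ordS i -> j != ord_pred i ->
  ccong [:: i; j] [:: j; i].
Proof.
move=> j1; rewrite eq_sym => j2.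
case: (eqVneq i j) => [->|ij]; first exact: ccong_refl.
by apply/ccong_rel/crel_comm => //; apply: contraNneq j2 => ->; rewrite ordSK.
Qed.

Lemma ccong_move i w : ordS i \notin w -> ord_pred i \notin w ->
  ccong (i :: w) (rcons w i).
Proof.
elim: w => [|j w IH] /=; first by move=> *; apply: ccong_refl.
rewrite !inE !negb_or => /andP[j1 w1] /andP[j2 w2].
apply: (@ccong_trans _ _ ([:: j; i] ++ w)).
  apply: (@ccong_cat _ [:: i; j]); last exact: ccong_refl.
  by apply: ccong_letters; rewrite eq_sym.
exact: (ccong_cat (ccong_refl [:: j]) (IH w1 w2)).
Qed.

(** Two letters either commute, and then idempotency applies, or are adjacent,
    and then one of the two braid relations does. *)
Lemma ccong_idem i j :
  (j != ord_pred i -> ccong [:: i; j; i] [:: i; j]) /\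
  (j != ordS i -> ccong [:: i; j; i] [:: j; i]).
Proof.
have cij : j != ordS i -> j != ord_pred i ->
    ccong [:: i; j; i] [:: i; j] /\ ccong [:: i; j; i] [:: j; i].
  move=> j1 j2; have c := ccong_letters j1 j2.
  have ii := ccong_rel (crel_idem i); split.
    apply: (@ccong_trans _ _ [:: i; i; j]).
      exact: (ccong_cat (ccong_refl [:: i]) (ccong_sym c)).
    exact: (ccong_cat ii (ccong_refl [:: j])).
  apply: (@ccong_trans _ _ [:: j; i; i]).
    exact: (ccong_cat c (ccong_refl [:: i])).
  exact: (ccong_cat (ccong_refl [:: j]) ii).
split=> jj.
- case: (eqVneq j (ordS i)) => [->|j1]; first exact/ccong_rel/crel_braidl.
  by case: (cij j1 jj).
- case: (eqVneq j (ord_pred i)) => [->|j1]; last by case: (cij jj j1).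
  by have := ccong_rel (crel_braidr (ord_pred i)); rewrite ord_predK.
Qed.

(** The last letter [i] is carried to the left through [i j i = i j]. *)
Lemma ccong_drop_last i w : ord_pred i \notin w ->
  ccong (i :: rcons w i) (i :: w).
Proof.
elim: w => [|j w IH] /=; first by move=> _; apply/ccong_rel/crel_idem.
rewrite inE negb_or eq_sym => /andP[ji /IH{}IH].
have iji := (ccong_idem i j).1 ji.
apply: (@ccong_trans _ _ ([:: i; j; i] ++ rcons w i)).
  exact: (ccong_cat (ccong_sym iji) (ccong_refl _)).
apply: (@ccong_trans _ _ ([:: i; j] ++ i :: w)).
  exact: (ccong_cat (ccong_refl [:: i; j]) IH).
exact: (ccong_cat iji (ccong_refl _)).
Qed.

(** The first letter [i] is carried to the right through [i j i = j i]. *)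
Lemma ccong_drop_first i w : ordS i \notin w ->
  ccong (i :: rcons w i) (rcons w i).
Proof.
elim: w => [|j w IH] /=; first by move=> _; apply/ccong_rel/crel_idem.
rewrite inE negb_or eq_sym => /andP[ji /IH{}IH].
have iji := (ccong_idem i j).2 ji.
apply: (@ccong_trans _ _ ([:: i; j; i] ++ rcons w i)).
  exact: (ccong_cat (ccong_refl [:: i; j]) (ccong_sym IH)).
apply: (@ccong_trans _ _ ([:: j; i] ++ rcons w i)).
  exact: (ccong_cat iji (ccong_refl _)).
exact: (ccong_cat (ccong_refl [:: j]) IH).
Qed.

Definition minlen w : Prop := forall v, ccong w v -> size w <= size v.

Lemma minlen_behead i w : minlen (i :: w) -> minlen w.
Proof.
move=> m v wv; apply: (m (i :: v)).
exact: (ccong_cat (ccong_refl [:: i]) wv).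
Qed.

(** Read the letter [i] as the move of a particle from site [i] to site
    [i + 1] of the cycle. Then site [i] is occupied at the start when it is
    left before it is entered. A site which is never left nor entered counts
    as occupied: its token stays there and meets no other. *)
Definition occ w i : bool := index i w <= index (ord_pred i) w.

Lemma occ_cons i w j :
  occ (i :: w) j = (j == i) || (j != ordS i) && occ w j.
Proof.
rewrite /occ /= -ordS_eq [ordS i == j]eq_sym [i == j]eq_sym.
by case: (j == i); case: (j == ordS i).
Qed.

Lemma index_split i w : i \in w ->
  exists2 ab, w = ab.1 ++ i :: ab.2 &
              forall j, j \in ab.1 -> index j w < index i w.
Proof.
move=> iw; exists (take (index i w) w, drop (index i w).+1 w) => /=.
  by rewrite -drop_index // cat_take_drop.
by move=> j /index_ltn.
Qed.

(** The letter [i] moves a particle to a free site: just after the move, site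
    [i + 1] is occupied, and site [i] is empty unless nothing touches it any
    more. *)
Fixpoint exclusion w : bool :=
  if w is i :: w' then
    [&& occ w' (ordS i),
        ~~ occ w' i || (i \notin w') && (ord_pred i \notin w') & exclusion w']
  else true.

(** If site [i + 1] is to be entered again before it is left, or site [i] to
    be left again before it is entered, then the next [i] comes before the
    next [i + 1], or before the next [i - 1], and one of the two letters [i]
    can be dropped. *)
Lemma minlen_exclusion w : minlen w -> exclusion w.
Proof.
elim: w => //= i w IH m; apply/and3P; split; last exact/IH/(minlen_behead m).
- rewrite /occ ordSK leqNgt; apply/negP => lt.
  have iw : i \in w by rewrite -index_mem; apply: leq_trans lt (index_size _ _).
  have [[a b] /= e lt_a] := index_split iw.
  have /ccong_drop_first c : ordS i \notin a.
    by apply/negP => /lt_a; rewrite ltnNge ltnW.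
  have /m : ccong (i :: w) (rcons a i ++ b).
    by rewrite e -cat_rcons -cat_cons; apply: ccong_cat c (ccong_refl _).
  by rewrite e -cat_rcons /= ltnn.
- rewrite -implybE; apply/implyP; rewrite /occ => le.
  have [iw|iw] := boolP (i \in w); last first.
    by rewrite -index_mem -leqNgt -(memNindex iw).
  have [[a b] /= e lt_a] := index_split iw.
  have /ccong_drop_last c : ord_pred i \notin a.
    by apply/negP => /lt_a; rewrite ltnNge le.
  have /m : ccong (i :: w) ((i :: a) ++ b).
    by rewrite e -cat_rcons -cat_cons; apply: ccong_cat c (ccong_refl _).
  by rewrite e -cat_rcons /= !size_cat size_rcons; lia.
Qed.

(** Every particle sweeps along the tokens between its own site and the next
    particle, so that the occupied sites are the first points of the blocks. *)
Lemma exclusion_jump w p i : exclusion w -> p.+1 %% n = i ->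
  (act w p < act w p.+1) = occ w i.
Proof.
move=> + pi; elim: w p i pi => [|j w IH] p i pi /=.
  by rewrite /occ /= ltnS leqnn.
case/and3P=> occ1 _ ex; have := cyclic_comp (act1_cyclic j) (act_cyclic w).
rewrite occ_cons /act1 pi; case: (eqVneq i j) => [ij|ij] /=.
  subst j; rewrite eqxx.
  have -> : p %% n == i = false.
    by apply/negbTE; rewrite -ordS_mod pi (inj_eq (@ord_inj _)) eq_sym ordS_neq.
  move=> _; have /eqP e : p.+2 %% n == ordS i by rewrite ordS_mod pi.
  rewrite -(IH _ _ e) // in occ1.
  by apply: leq_ltn_trans occ1; case: (act_cyclic w) => m _ _; apply: m.
move: ij; rewrite -(inj_eq (@ord_inj _)) => /negbTE-> _.
rewrite -ordS_mod pi (inj_eq (@ord_inj _)).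
by case: (eqVneq i (ordS j)) => [_|_] /=; rewrite ?ltnn // (IH _ _ pi).
Qed.

(** The value at the positions that the first letter clears is not visible in
    the action of [i :: w]; it can be recovered from the value one step
    before. *)
Lemma exclusion_fill i w p : exclusion (i :: w) -> p.+1 %% n = i ->
  act w p.+1 = maxn p.+1 (act w p).
Proof.
case: (act_cyclic w) => m _ inf /and3P[_ /orP[occ0|/andP[iw _]] ex] pi.
- have := exclusion_jump ex pi; rewrite (negbTE occ0).
  by have := m _ _ (leqnSn p); have := inf p.+1; lia.
- have e : act w p.+1 = p.+1.
    apply: act_notin => j; rewrite pi; apply: contraTneq => /ord_inj<-; exact: iw.
  by have := m _ _ (leqnSn p); rewrite e; lia.
Qed.

(** ** The action is faithful *)

Lemma occ_front w i : occ w i -> ~~ occ w (ordS i) ->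
  exists a b,
    [/\ w = a ++ i :: b, i \notin a, ordS i \notin a & ord_pred i \notin a].
Proof.
rewrite /occ ordSK -ltnNge => le lt.
have iw : i \in w by rewrite -index_mem; apply: leq_trans lt (index_size _ _).
have [[a b] /= e lt_a] := index_split iw.
exists a, b; split=> //; apply/negP => /lt_a; lia.
Qed.

Lemma ccong_front a b i : ordS i \notin a -> ord_pred i \notin a ->
  ccong (a ++ i :: b) (i :: a ++ b).
Proof.
move=> a1 a2; rewrite -cat_rcons -cat_cons.
by apply: ccong_cat (ccong_refl _); apply/ccong_sym/ccong_move.
Qed.

Lemma minlen_ccong_size u v : minlen u -> ccong u v -> size v = size u -> minlen v.
Proof. by move=> m uv e w vw; rewrite e; apply: m; apply: ccong_trans vw. Qed.

(** By [exclusion_jump] the common map shows that the first letter of [u] can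
    also be moved to the front of [v]. It is removed from both words; by
    [exclusion_fill] the remaining words still have the same action. *)
Lemma minlen_faithful u v : minlen u -> minlen v -> act u =1 act v -> ccong u v.
Proof.
elim: u v => [|i u IH] v mu mv e.
  case: v mv e => [|j v] mv e; first exact: ccong_refl.
  have := e j; rewrite /= /act1 modn_small // eqxx.
  by case: (act_cyclic v) => _ _ /(_ j.+1); lia.
have xu := minlen_exclusion mu; have xv := minlen_exclusion mv.
have occE j : occ v j = occ (i :: u) j.
  have [p pj] : exists p, p.+1 %% n = j.
    by exists (j + n.-1); rewrite -addnS prednK // modnDr modn_small.
  by rewrite -(exclusion_jump xv pj) -(exclusion_jump xu pj) !e.
have occ1 : occ v i by rewrite occE occ_cons eqxx.
have occ2 : ~~ occ v (ordS i).
  by rewrite occE occ_cons eqxx (negbTE (ordS_neq _)).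
have [a [b [ev ia ia1 ia2]]] := occ_front occ1 occ2.
have vc : ccong v (i :: a ++ b) by rewrite ev; apply: ccong_front.
have mab : minlen (i :: a ++ b).
  by apply: (minlen_ccong_size mv vc); rewrite ev /= !size_cat addnS.
suffices c : ccong u (a ++ b).
  exact: ccong_trans (ccong_cat (ccong_refl [:: i]) c) (ccong_sym vc).
have xab := minlen_exclusion mab.
apply: IH (minlen_behead mu) (minlen_behead mab) _.
have e' : act (i :: u) =1 act (i :: a ++ b) by move=> p; rewrite e (ccong_act vc).
have off p : p %% n != i -> act u p = act (a ++ b) p.
  by move=> /negbTE pi; have := e' p; rewrite /= /act1 pi.
have on p : p.+1 %% n = i -> act u p.+1 = act (a ++ b) p.+1.
  move=> pi; rewrite (exclusion_fill xu pi) (exclusion_fill xab pi) off //.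
  by rewrite -ordS_mod pi (inj_eq (@ord_inj _)) eq_sym ordS_neq.
apply: (cyclic_ext (act_cyclic u) (act_cyclic _)) => p _.
have [pi|/off//] := eqVneq (p %% n) i.
case: (act_cyclic u) => _ uD _; case: (act_cyclic (a ++ b)) => _ vD _.
apply: (@addIn n); rewrite -uD -vD.
have e1 : p + n = (p + n.-1).+1 by rewrite -addnS prednK.
by rewrite e1; apply: on; rewrite -e1 modnDr.
Qed.

(** * The maps realised by words *)

Lemma fixed_strict_id s q : cyclic s -> s q = q ->
  (forall p, s p < s p.+1) -> s =1 id.
Proof.
move=> cs sq sS p; have := strict_shift q cs sS.
by rewrite (strict_shift p cs sS); lia.
Qed.

Lemma strictP s : cyclic s -> (forall p, s p < s p.+1) \/ exists p, s p = s p.+1.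
Proof.
case=> m _ _; have [|nex] := pselect (exists p, s p = s p.+1); first by right.
left=> p; rewrite ltn_neqAle m // andbT.
by apply/eqP => e; apply: nex; exists p.
Qed.

Lemma block_start s : cyclic s -> (exists p, s p = s p.+1) ->
  exists2 q, s q < s q.+1 & s q.+1 = s q.+2.
Proof.
move=> [m sD _] [p0 e0].
have ex : exists q, s q == s (p0 + n) by exists (p0 + n).
case: (ex_minnP ex) => q /eqP sq min_q.
have le_q : q <= p0 + n by apply: min_q.
have s0 : s 0 < s q by rewrite sq sD; have := m 0 p0 (leq0n _); lia.
case: q sq min_q le_q s0 => [|q] sq min_q le_q; first by rewrite ltnn.
move=> _.
exists q; first rewrite ltn_neqAle m // andbT.
  by apply/negP => /eqP e; have := min_q q; rewrite e sq eqxx; lia.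
apply/eqP; rewrite eqn_leq m //= sq sD e0 -sD addSn; exact: m.
Qed.

(** The first letter is chosen at the first point [q] of a block of at least
    two points, and the value at [q] is lowered as far as monotonicity and
    [q <= s q] allow. Then either [q] joins the previous block or it becomes a
    fixed point; in the latter case the new map is the identity unless it has
    a nonjump. The sum of the values on a period decreases. *)
Lemma act_surj s : cyclic s -> s =1 id \/ (exists p, s p = s p.+1) ->
  exists w, act w =1 s.
Proof.
have [N] := ubnP (\sum_(p < n) s p); elim: N s => // N IH s le_N cs [s_id|].
  by exists [::] => p; rewrite s_id.
move=> /(block_start cs)[q0 q0q]; set q := q0.+1 => sq.
have [sm sD si] := cs.
pose i : 'I_n := Ordinal (ltn_pmod q n_gt0).
pose c := maxn q (s q0).
have lt_c : c < s q by rewrite /c gtn_max q0q sq si.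
pose s' p := if p %% n == i then s p - (s q - c) else s p.
have s_at p : p %% n == i -> s p + q = s q + p.
  by move=> /eqP pi; apply: (cyclic_congr cs).
have s_pred p : p.+1 %% n == i -> s p + q0 = s q0 + p.
  move=> pi; apply: (cyclic_congr cs); apply/eqP.
  have : p.+1 == q %[mod n] by rewrite (eqP pi).
  by rewrite -[p.+1]addn1 -[q]/(q0.+1) -[q0.+1]addn1 eqn_modDr.
have s_next p : p %% n == i -> s p.+1 = s p.
  move=> pi; have := s_at p pi.
  have : s p.+1 + q.+1 = s q.+1 + p.+1.
    apply: (cyclic_congr cs); apply/eqP.
    rewrite -[p.+1]addn1 -[q.+1]addn1 eqn_modDr.
    by rewrite (eqP pi).
  by rewrite -sq; lia.
have le_qc : q <= c by apply: leq_maxl.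
have s'_lt p : p %% n == i -> s' p < s p.
  by move=> pi; rewrite /s' pi; have := s_at p pi; have := si p; lia.
have cs' : cyclic s'.
  split=> [|p|p].
  - apply: homo_leq => // [p r u|p]; first exact: leq_trans.
    rewrite /s'; case: ifP => pi; last case: ifP => pi1.
    + rewrite [X in _ <= (if X then _ else _)](_ : _ = false).
        by rewrite s_next // leq_subr.
      apply/negbTE; rewrite (modnS_n) (eqP pi) /=.
      by have := ltn_ord i; rewrite /=; case: ifP; lia.
    + have := s_pred p pi1; have := s_at _ pi1; have := leq_maxr q (s q0).
      by rewrite -/c /q in lt_c le_qc sq *; lia.
    + exact: sm.
  - rewrite /s' modnDr sD; case: ifP => // pi.
    by have := s_at _ pi; lia.
  - rewrite /s'; case: ifP => // pi; have := s_at _ pi; lia.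
have s'_ok : s' =1 id \/ (exists p, s' p = s' p.+1).
  have [|] := strictP cs'; last by right.
  have s'q : s' q = c by rewrite /s' eqxx; lia.
  have s'q0 : s' q0 = s q0.
    rewrite /s' ifF // /i /= /q (modnS_n).
    by have := ltn_pmod q0 n_gt0; case: ifP; lia.
  case: (leqP (s q0) q) => [le|gt] strict.
    left; apply: (@fixed_strict_id _ q) => //; rewrite s'q /c; lia.
  by have := strict q0; rewrite s'q0 s'q /c; lia.
have [|w ws'] := IH s' _ cs' s'_ok.
  rewrite -ltnS; apply: leq_ltn_trans le_N.
  rewrite (bigD1 i) //= [X in _ < X](bigD1 i) //=.
  rewrite -addSn; apply: leq_add.
    by apply: s'_lt; rewrite modn_mod.
  by apply: leq_sum => j _; rewrite /s'; case: ifP => // _; rewrite leq_subr.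
exists (i :: w) => p; rewrite /act /= -/(act w _) ws' /act1 /s'.
case: (p %% n =P i) => [/eqP pi|/eqP/negbTE->//].
rewrite ifF ?s_next //; apply/negbTE; rewrite (modnS_n) (eqP pi) /=.
by have := ltn_pmod q n_gt0; case: ifP; lia.
Qed.

Lemma nonjump f : jumps f n < n -> {homo f : p q / p <= q} ->
  exists p, f p = f p.+1.
Proof.
move=> lt m; apply: contrapT => nex; move: lt; rewrite ltnNge => /negP; apply.
rewrite /jumps -[X in X <= _]muln1 -[X in X * _]subn0 -sum_nat_const_nat.
apply: leq_sum => p _; rewrite lt0b ltn_neqAle m // andbT.
by apply/eqP => e; apply: nex; exists p.
Qed.

Lemma constant_transfer f h p q : {homo f : p q / p <= q} ->
    (forall p, f p = f p.+1 -> h p = h p.+1) ->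
  p <= q -> f p = f q -> h p = h q.
Proof.
move=> fm fh /subnKC<-; elim: (q - p) => [|k IH]; first by rewrite addn0.
rewrite addnS => e.
have e1 : f p = f (p + k).
  by apply/eqP; rewrite eqn_leq fm ?leq_addr //= e fm.
by rewrite IH // fh // -e1.
Qed.

(** The divisor sends [y] to the value of [h] on the first block of [f] whose
    value reaches [y]. The shift by [M * n] brings [y] above [f 0]; for
    smaller [y] this block may lie at negative positions. *)
Lemma right_divisor f h : cyclic f -> cyclic h ->
    (exists p, f p = f p.+1) -> (forall p, f p <= h p) ->
    (forall p, f p = f p.+1 -> h p = h p.+1) ->
  exists w, (forall p, act w (f p) = h p) /\
    forall x, exists M p, x + M * n <= f p /\ act w x + M * n = h p.
Proof.
move=> cf ch fnj le_fh fh; have [fm fD fi] := cf; have [hm hD hi] := ch.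
have ex y : exists q, y <= f q by exists y.
pose ph y := ex_minn (ex y).
have phP y : y <= f (ph y) by rewrite /ph; case: ex_minnP.
have ph_min y q : y <= f q -> ph y <= q.
  by rewrite /ph; case: ex_minnP => m _; apply.
have ph_mono y z : y <= z -> ph y <= ph z.
  by move=> le; apply: ph_min; apply: leq_trans (phP z).
have phD y : f 0 < y -> ph (y + n) = ph y + n.
  move=> lt; apply/eqP; rewrite eqn_leq; apply/andP; split.
    by apply: ph_min; rewrite fD leq_add2r.
  have := phP (y + n); case: (leqP n (ph (y + n))) => [le|/ltnW/fm].
    rewrite -{1}(subnK le) fD leq_add2r => /ph_min; lia.
  by have := fD 0; rewrite add0n; lia.
pose M := (f 0).+1; have ltM y : f 0 < y + M * n.
  by apply: leq_trans (leq_addl _ _); rewrite leq_pmulr.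
pose s y := h (ph (y + M * n)) - M * n.
have sE y : s y + M * n = h (ph (y + M * n)).
  rewrite subnK //; apply: leq_trans (le_fh _); apply: leq_trans (phP _).
  exact: leq_addl.
have cs : cyclic s.
  split=> [y z le|y|y].
  - by rewrite leq_sub2r // hm // ph_mono // leq_add2r.
  - apply: (@addIn (M * n)); rewrite addnAC !sE -hD -phD //.
    by rewrite addnAC.
  - rewrite -(leq_add2r (M * n)) sE.
    exact: leq_trans (phP _) (le_fh _).
(* The values that [f] skips below [f p.+1] have the same first block. *)
have snj : exists p, s p = s p.+1.
  have [p0 e0] := fnj; have [p gap] := nonjump_gap cf e0.
  exists (f p.+1).-1; rewrite prednK; last by lia.
  apply: (@addIn (M * n)); rewrite !sE; congr h.
  apply/eqP; rewrite eqn_leq ph_mono /=; last by rewrite leq_add2r leq_pred.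
  have lt_pred : f p < (f p.+1).-1 by lia.
  apply: ph_min; rewrite -(cyclicDM M _ cf) fm // addSn.
  rewrite ltnNge; apply/negP => /fm; rewrite (cyclicDM M _ cf).
  by have := phP ((f p.+1).-1 + M * n); lia.
have [w ws] := act_surj cs (or_intror snj).
exists w; split=> [p|x]; last first.
  by exists M, (ph (x + M * n)); rewrite ws sE; split.
rewrite ws; apply: (@addIn (M * n)).
rewrite sE -!(cyclicDM M _ ch) -(cyclicDM M _ cf).
have le := ph_min _ _ (leqnn (f (p + M * n))).
apply: (constant_transfer fm fh le).
by apply/eqP; rewrite eqn_leq phP fm.
Qed.

(** Let [h] send the block of [f] with a given number to the right end of the
    block of [g] with the same number, and shift [h] up by a multiple of [n].
    The quotient of [h] by [f] is the map looked for: its blocks end at the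
    points of the image of [f], as [h] and [f] have the same blocks. *)
Lemma connecting_word f g N : cyclic f -> cyclic g ->
    jumps f n = jumps g n -> jumps f n < n ->
  exists w, [/\ N <= act w 0,
    forall x q, act w x <= act w (f q) -> x <= f q &
    forall q, g (act w q) < g (act w q).+1].
Proof.
move=> cf cg efg rk_f; have [fm fD fi] := cf; have [gm gD gi] := cg.
have fnj := nonjump rk_f fm.
have ex p : exists x, g x < g x.+1 /\ jumps g x = jumps f p.
  by have [x] := jump_at (jumps f p) cg; exists x.
pose r p := sval (cid (ex p)).
have rP p : g (r p) < g (r p).+1 by rewrite /r; case: cid => x [].
have rJ p : jumps g (r p) = jumps f p by rewrite /r; case: cid => x [].
have r_uniq x y : g x < g x.+1 -> g y < g y.+1 -> jumps g x = jumps g y -> x = y.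
  wlog lt : x y / x < y => [H jx jy e|jx _ e].
    by case: (ltngtP x y) => // lt; [apply: H | apply/esym/H].
  by have := jumps_le g lt; rewrite jumpsS jx; lia.
have rD p : r (p + n) = r p + n.
  apply: r_uniq => //; first by rewrite -addSn !gD ltn_add2r.
  by rewrite rJ !jumpsD // rJ efg.
have r_lt p q : (r p < r q) = (f p < f q).
  rewrite -(jumps_lt p q fm) -!rJ (jumps_lt (r p) (r q) gm).
  apply/idP/idP => [lt|]; last by rewrite !ltnNge; apply: contra => /gm.
  by apply: leq_trans (rP p) _; apply: gm.
have r_le p q : (r p <= r q) = (f p <= f q) by rewrite leqNgt r_lt -leqNgt.
(* On the first period [f] is at most [f n], so that [h] exceeds [f] by [N]. *)
pose L := N + f n; pose h p := r p + L * n.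
have hE p q : (h p <= h q) = (f p <= f q) by rewrite leq_add2r.
have le_L : L <= L * n by rewrite leq_pmulr.
have f_le_h p : f p + N <= h p.
  elim/cyclic_ind: p => [p|p /ltnW/fm le]; rewrite /h ?fD ?rD.
    by rewrite /h; lia.
  by rewrite /L in le_L *; lia.
have ch : cyclic h.
  split=> [p q le|p|p]; first by rewrite hE fm.
  - by rewrite /h rD addnAC.
  - by apply: leq_trans (leq_trans (fi p) (leq_addr N _)) (f_le_h p).
have [||w [wf wx]] := right_divisor cf ch fnj.
- by move=> p; apply: leq_trans (leq_addr N _) (f_le_h p).
- by move=> p e; apply/eqP; rewrite eqn_leq !hE e leqnn.
have [wm wD wi] := act_cyclic w.
exists w; split=> [|x q le|q].
- have [M [p [le e]]] := wx 0.
  by have := f_le_h p; lia.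
- have [M [p [le_x e]]] := wx x.
  have : h p <= h (q + M * n) by rewrite -e (cyclicDM M _ ch) leq_add2r -wf.
  rewrite hE (cyclicDM M _ cf) => le_p.
  by rewrite -(leq_add2r (M * n)); apply: leq_trans le_p.
- have [M [p [_ e]]] := wx q.
  rewrite -(ltn_add2r (M * n)) -!(cyclicDM M _ cg) addSn e /h -addSn.
  by rewrite !(cyclicDM L _ cg) ltn_add2r.
Qed.

(** * The rank of the reduced forms *)

Lemma uniq_exclusion w : uniq w -> exclusion w.
Proof.
elim: w => //= i w IH /andP[iw /IH->]; rewrite andbT.
rewrite /occ ordSK (memNindex iw) index_size /= iw /=.
by rewrite -ltnNge index_mem orbN.
Qed.

Lemma jumps_act w : exclusion w -> jumps (act w) n = \sum_(i < n) occ w i.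
Proof.
move=> xw; rewrite (reindex_inj (@ordS_inj n)) /jumps big_mkord.
by apply: eq_bigr => i _; rewrite (exclusion_jump xw (erefl : i.+1 %% n = ordS i)).
Qed.

(** A letter that occurs again later leaves an empty site behind, so that the
    move only exchanges the states of two neighbouring sites. *)
Lemma sum_occ_cat u v : exclusion (u ++ v) -> (forall i, i \in v) ->
  \sum_(i < n) occ (u ++ v) i = \sum_(i < n) occ v i.
Proof.
move=> + all_v; elim: u => //= i u IH /and3P[occ1 occ0 /IH<-].
rewrite (reindex_inj (@perm_inj _ (tperm i (ordS i)))) /=.
apply: eq_bigr => j _; rewrite occ_cons.
rewrite mem_cat all_v orbT andFb orbF in occ0.
case: tpermP => [->|->|/eqP/negbTE-> /eqP->] //.
- by rewrite eqxx (negbTE (ordS_neq i)) (negbTE occ0).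
- by rewrite eqxx occ1.
Qed.

Lemma occ_cat u v i : (forall j, j \in u) -> occ (u ++ v) i = occ u i.
Proof. by move=> all_u; rewrite /occ !index_cat !all_u. Qed.

Lemma sum_above t m : \sum_(k < m) (t < k) = m - t.+1.
Proof.
rewrite -(big_mkord xpredT (fun k => (t < k) : nat)).
elim: m => [|m IH]; first by rewrite big_geq.
by rewrite big_nat_recr //= IH; lia.
Qed.

(** * Reduced words are greedy *)

Definition lexmin w : Prop := forall v, ccong w v -> deglex w v.

Lemma lexmin_minlen w : lexmin w -> minlen w.
Proof.
by move=> m v /m; rewrite /deglex => /orP[/ltnW//|/andP[/eqP->]].
Qed.

Lemma deglex_cons i u v : deglex (i :: u) (i :: v) = deglex u v.
Proof. by rewrite /deglex /= ltnS eqSS lexi_cons lexx. Qed.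

Lemma lexmin_behead i w : lexmin (i :: w) -> lexmin w.
Proof.
move=> m v wv; rewrite -(deglex_cons i).
exact/m/(ccong_cat (ccong_refl [:: i]) wv).
Qed.

Lemma lexmin_cat u v : lexmin (u ++ v) -> lexmin v.
Proof. by elim: u => //= i u IH /lexmin_behead. Qed.

(** A particle that is free to move can move first; so the first letter of a
    reduced word moves the free particle of least index. *)
Lemma lexmin_head i v j : lexmin (i :: v) ->
  occ (i :: v) j -> ~~ occ (i :: v) (ordS j) -> i <= j.
Proof.
move=> m o1 o2; have [a [b [e _ a1 a2]]] := occ_front o1 o2.
have /m : ccong (i :: v) (j :: a ++ b) by rewrite e; apply: ccong_front.
rewrite /deglex /= ltnS eqSS.
have -> : size v = size (a ++ b).
  by apply: succn_inj; rewrite -[LHS]/(size (i :: v)) e !size_cat addnS.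
by rewrite ltnn eqxx /= lexi_cons => /andP[].
Qed.

(** The first letter moves a free particle, hence one of index at least [i];
    and by [lexmin_head] it moves none of larger index. *)
Lemma greedy_step v (P : pred nat) i : lexmin v -> (forall j, occ v j = P j) ->
    P i -> ~~ P (ordS i) -> (forall j, j < i -> P j -> P (ordS j)) ->
    (forall j, j \in behead v) ->
  exists2 v', v = i :: v' &
    forall j, occ v' j = (j == ordS i :> nat) || (j != i :> nat) && P j.
Proof.
move=> mv occP Pi Pi1 least; case: v mv occP => [|j v] mv occP all_v.
  by have := all_v i.
have Pj : P j by rewrite -occP occ_cons eqxx.
have Pj1 : ~~ P (ordS j).
  by rewrite -occP occ_cons eqxx (negbTE (ordS_neq j)).
have eij : j = i.
  apply/eqP; rewrite -(inj_eq (@ord_inj _)) eqn_leq.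
  rewrite (lexmin_head mv) ?occP // leqNgt.
  by apply/negP => /least/(_ Pj); apply/negP.
subst j; exists v => // j; rewrite !(inj_eq (@ord_inj _)) -occP occ_cons.
have /= /and3P[occ1 occ0 _] := minlen_exclusion (lexmin_minlen mv).
rewrite [i \in v]all_v andFb orbF in occ0.
case: (eqVneq j (ordS i)) => [->//|_] /=.
by case: (eqVneq j i) => [->|]; first exact/negbTE.
Qed.

Section Packed.
Variable t : nat.
Hypothesis t_lt : t.+1 < n.

Let letters : [seq (val i).+1 | i <- xq n t] = n :: q n t.
Proof. by apply: word_xq; lia. Qed.

Lemma mem_q k : (k \in q n t) = (0 < k < n).
Proof. by rewrite mem_cat mem_rev !mem_iota; lia. Qed.

Lemma mem_xq i : i \in xq n t.
Proof.
rewrite -(mem_map (f := fun i : 'I_n => (val i).+1)) ?letters.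
  by rewrite inE mem_q /=; have := ltn_ord i; lia.
by move=> j k /= [/ord_inj].
Qed.

Lemma uniq_xq : uniq (xq n t).
Proof.
rewrite -(map_inj_uniq (f := fun i : 'I_n => (val i).+1)) ?letters.
  rewrite /= mem_q ltnn andbF /= cat_uniq rev_uniq !iota_uniq andbT /=.
  by apply/hasPn => k; rewrite mem_rev !mem_iota; lia.
by move=> j k /= [/ord_inj].
Qed.

Lemma index_rev_iota a m k : a <= k < a + m ->
  index k (rev (iota a m)) = a + m - k.+1.
Proof.
move=> km; have {1}-> : k = nth 0 (rev (iota a m)) (a + m - k.+1).
  by rewrite nth_rev size_iota ?nth_iota; lia.
by rewrite index_uniq ?rev_uniq ?iota_uniq // size_rev size_iota; lia.
Qed.

Lemma index_iota1 m k : 0 < k <= m -> index k (iota 1 m) = k.-1.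
Proof.
move=> km; have {1}-> : k = nth 0 (iota 1 m) k.-1 by rewrite nth_iota; lia.
by rewrite index_uniq ?iota_uniq // size_iota; lia.
Qed.

Lemma index_q k : 0 < k < n ->
  index k (q n t) = if k <= t then k.-1 else t + (n - k.+1).
Proof.
move=> kn; rewrite index_cat mem_iota size_iota; case: (leqP k t) => kt.
  by rewrite ifT ?index_iota1 //; lia.
by rewrite ifF ?index_rev_iota; lia.
Qed.

(** This packed state is also the one that the greedy word reaches before it
    spells [xq n t]. *)
Lemma occ_xq i : occ (xq n t) i = (t < i).
Proof.
have inj : injective (fun i : 'I_n => (val i).+1) by move=> j k [/ord_inj].
have pred_i := ord_pred_val i; rewrite /= in pred_i.
rewrite /occ -!(index_map inj) letters /= pred_i {pred_i}.
have := ltn_ord i; case: (i =P 0 :> nat) => [->|i0] lt_i.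
  by rewrite prednK // eqxx; case: eqP; lia.
rewrite prednK ?lt0n; last exact/eqP.
case: (n =P i.+1) => [|ni]; first by case: eqP; lia.
rewrite ifF ?index_q; try lia.
by rewrite ltnS; case: (leqP i.+1 t); case: (leqP i t); lia.
Qed.

(** All letters occur in the factor, so that the state before it is known, and
    moves do not change the number of particles. *)
Lemma rank_infix w : exclusion w -> infix (xq n t) w ->
  jumps (act w) n = n - t.+1.
Proof.
move=> xw /infixP[a [b e]]; rewrite jumps_act // e.
rewrite sum_occ_cat -?e // => [|i]; last by rewrite mem_cat mem_xq.
rewrite -(sum_above t n); apply: eq_bigr => i _.
by rewrite occ_cat ?occ_xq // => j; apply: mem_xq.
Qed.

Lemma rank_xq : jumps (act (xq n t)) n = n - t.+1.
Proof.
apply: rank_infix; last exact: infix_refl.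
exact/uniq_exclusion/uniq_xq.
Qed.

(** The particle entering at site [0] runs up to the packed ones. *)
Lemma greedy_rise m k v : k + m = t -> lexmin v -> (forall j, j \in drop m v) ->
    (forall j, occ v j = (j == k :> nat) || (t < j < n.-1)) ->
  exists w v', [/\ v = w ++ v', [seq (val i).+1 | i <- w] = iota k.+1 m &
                  forall j, occ v' j = (t <= j < n.-1)].
Proof.
elim: m k v => [|m IH] k v km mv all_v occP.
  by exists [::], v; split=> // j; rewrite occP; lia.
have k_lt : k < n by lia.
have Sk : ordS (Ordinal k_lt) = k.+1 :> nat by rewrite ordS_val /= ifF //; lia.
pose P p := (p == k) || (t < p < n.-1).
have [||j lt_j|j|v' ev occv'] := @greedy_step v P (Ordinal k_lt) mv occP;
    rewrite ?Sk /P /=; try lia.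
- by move: lt_j; rewrite /=; lia.
- by have := all_v j; rewrite -drop1 -[m.+1]addn1 -drop_drop => /mem_drop.
have all_v' j : j \in drop m v' by have := all_v j; rewrite ev.
have mv' : lexmin v' by move: mv; rewrite ev => /lexmin_behead.
have km' : k.+1 + m = t by lia.
have occP' j : occ v' j = (j == k.+1 :> nat) || (t < j < n.-1).
  by rewrite occv' Sk /P /=; lia.
have [w [v2 [e w_k occ2]]] := IH k.+1 v' km' mv' all_v' occP'.
by exists (Ordinal k_lt :: w), v2; rewrite ev e /= w_k.
Qed.

(** The packed particles then advance by one site, the front one first. *)
Lemma greedy_fall m v : t + m < n -> lexmin v -> (forall j, j \in drop m v) ->
    (forall j, occ v j = (t <= j < t + m) || (t + m < j)) ->
  exists w v', v = w ++ v' /\ [seq (val i).+1 | i <- w] = rev (iota t.+1 m).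
Proof.
elim: m v => [|m IH] v lt_m mv all_v occP; first by exists [::], v.
have k_lt : t + m < n by lia.
have Sk : ordS (Ordinal k_lt) = (t + m).+1 :> nat.
  by rewrite ordS_val /= ifF //; lia.
pose P p := (t <= p < t + m.+1) || (t + m.+1 < p).
have [||j lt_j|j|v' ev occv'] := @greedy_step v P (Ordinal k_lt) mv occP;
    rewrite ?Sk /P /=; try lia.
- by move: lt_j; rewrite modnS_n (modn_small (ltn_ord j)) /=; case: ifP; lia.
- by have := all_v j; rewrite -drop1 -[m.+1]addn1 -drop_drop => /mem_drop.
have all_v' j : j \in drop m v' by have := all_v j; rewrite ev.
have mv' : lexmin v' by move: mv; rewrite ev => /lexmin_behead.
have occP' j : occ v' j = (t <= j < t + m) || (t + m < j).
  by rewrite occv' Sk /P /=; lia.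
have [w [v2 [e w_k]]] := IH v' k_lt mv' all_v' occP'.
exists (Ordinal k_lt :: w), v2; rewrite ev e; split=> //.
rewrite -[rev _]/(rev (iota t.+1 (1 + m))) [1 + m]addnC iotaD rev_cat /= w_k.
by rewrite addSn.
Qed.

(** No particle on the sites before [n.-1] is free, since it would have moved
    first; so the occupied sites form a final segment. *)
Lemma lexmin_packed i v : i.+1 = n -> lexmin (i :: v) ->
    \sum_(j < n) occ (i :: v) j = n - t.+1 ->
  forall j, occ (i :: v) j = (t < j).
Proof.
move=> i_last mv sum_occ.
(* The default value continues the final segment beyond the cycle. *)
pose P p := if insub p is Some j then occ (i :: v) j else true.
have P_ord j : P j = occ (i :: v) j by rewrite /P valK.
have P_up p : P p -> P p.+1.
  rewrite /P; case: insubP => [j lt_j ej o1|]; case: insubP => //=.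
    move=> j1 lt_j1 ej1; apply: contraT => nj1.
    suffices e : ordS j = j1.
      by have := lexmin_head mv o1; rewrite e => /(_ nj1); move: ej ej1 => /=; lia.
    by apply/ord_inj; rewrite ordS_val; move: ej ej1 => /= -> ->; case: ifP; lia.
  by move=> j lt_j _ ; lia.
have P_last : P i by rewrite P_ord occ_cons eqxx.
have exP : exists p, P p by exists i.
case: (ex_minnP exP) => c Pc min_c.
have PE p : P p = (c <= p).
  apply/idP/idP => [/min_c//|/subnKC<-].
  by elim: (p - c) => [|k IH]; rewrite ?addn0 // addnS; apply: P_up.
have c_le : c <= i by apply: min_c.
have c_gt0 : 0 < c.
  rewrite lt0n; apply/negP => /eqP c0.
  have : P (ordS i) by rewrite PE c0.
  by rewrite P_ord occ_cons eqxx (negbTE (ordS_neq i)).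
have : \sum_(j < n) (c.-1 < j) = n - t.+1.
  by rewrite -sum_occ; apply: eq_bigr => j _; rewrite -P_ord PE prednK.
rewrite sum_above => e j; rewrite -P_ord PE; lia.
Qed.

(** Before the first letter [n.-1] the token of position [0] stays below [n],
    and [n] letters later it is still below [2 * n]. To reach [3 * n] it needs
    every letter once more, which is the supply that the greedy moves along
    [xq n t] require. *)
Lemma lexmin_infix w : lexmin w -> jumps (act w) n = n - t.+1 ->
  3 * n <= act w 0 -> infix (xq n t) w.
Proof.
move=> mw rk_w large.
have last_lt : n.-1 < n by rewrite prednK.
pose z : 'I_n := Ordinal last_lt.
have zw : z \in w.
  apply/negPn/negP => /(@act_barrier _ _ 0 n.-1); rewrite modn_small //.
  by move=> /(_ erefl (leq0n _)); lia.
have [[a b] /= e lt_a] := index_split zw.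
have za : z \notin a by apply/negP => /lt_a; rewrite ltnn.
have le_a : act a 0 <= n.-1.
  by apply: (act_barrier za) => //; rewrite modn_small.
have mv : lexmin (z :: b) by move: mw; rewrite e => /lexmin_cat.
have all_v i : i \in drop n (z :: b).
  apply/negPn/negP => notin.
  have := @act_barrier i _ (act (take n (z :: b)) (act a 0)) (2 * n + i) notin.
  rewrite -!act_cat -catA cat_take_drop -e modnMDl modn_small // => /(_ erefl).
  have := act_le_size (take n (z :: b)) (act a 0); rewrite act_cat size_take_min.
  by have := geq_minl n (size (z :: b)); have := ltn_ord i; lia.
have occ_v j : occ (z :: b) j = (t < j).
  apply: (lexmin_packed (i := z) (prednK n_gt0) mv).
  have xw := minlen_exclusion (lexmin_minlen mw).
  rewrite -rk_w jumps_act // {1}e sum_occ_cat -?e // => i.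
  exact: mem_drop (all_v i).
have mb := lexmin_behead mv.
have Sz : ordS z = 0 :> nat by rewrite ordS_val /= prednK // eqxx.
have occ_b j : occ b j = (j == 0 :> nat) || (t < j < n.-1).
  have [||k lt_k|k|b' [<-] ->] := @greedy_step _ (fun p => t < p) z mv occ_v;
      rewrite ?Sz //=.
  - by lia.
  - by move: lt_k; rewrite modnS_n (modn_small (ltn_ord k)) /=; case: ifP; lia.
  - have := all_v k; rewrite -[X in drop X](prednK n_gt0) /=; exact: mem_drop.
  - by have := ltn_ord j; lia.
have le_t : t <= n.-1 by lia.
have all_b i : i \in drop t b.
  have := all_v i; rewrite -[X in drop X](prednK n_gt0) /=.
  by rewrite -(subnK le_t) -drop_drop => /mem_drop.
have [w1 [b1 [e1 m1 occ1]]] := greedy_rise (add0n t) mb all_b occ_b.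
have size1 : size w1 = t by rewrite -(size_map (fun i => (val i).+1)) m1 size_iota.
have lt_m : t + (n.-1 - t) < n by lia.
have all_b1 i : i \in drop (n.-1 - t) b1.
  have := all_v i; rewrite -[X in drop X](prednK n_gt0) /= e1.
  by rewrite -{1}(subnK le_t) -drop_drop -{2}size1 drop_size_cat.
have mb1 : lexmin b1 by move: mb; rewrite e1 => /lexmin_cat.
have [|w2 [b2 [e2 m2]]] := greedy_fall lt_m mb1 all_b1.
  by move=> j; rewrite occ1; have := ltn_ord j; lia.
have -> : xq n t = z :: w1 ++ w2.
  apply: (inj_map (f := fun i : 'I_n => (val i).+1)).
    by move=> i j /= [/ord_inj].
  by rewrite letters /= map_cat m1 m2 prednK.
by apply/infixP; exists a, b2; rewrite e e1 e2 /= -catA.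
Qed.

End Packed.
(** * Elements of the monoid as maps *)

Definition mact (x : Cmon n) : nat -> nat := act (crep x).

Definition rank f : nat := jumps f n.

Lemma mact_cls w : mact (cls w) =1 act w.
Proof. by apply/ccong_act/clsP; rewrite crepK. Qed.

Lemma mactM x y p : mact (x * y)%g p = mact y (mact x p).
Proof. by rewrite mact_cls act_cat. Qed.

Lemma mact_cyclic x : cyclic (mact x).
Proof. exact: act_cyclic. Qed.

Lemma reduced_lexmin x w : reduced_form x w -> lexmin w.
Proof. by move=> [e m] v wv; apply: m; rewrite -e; apply/clsP/ccong_sym. Qed.

Lemma mact_inj x y : mact x =1 mact y -> x = y.
Proof.
have [u ru] := reduced_form_ex x; have [v rv] := reduced_form_ex y.
have [mu mv] := (reduced_lexmin ru, reduced_lexmin rv).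
case: ru rv => [<- _] [<- _] e; apply/clsP/minlen_faithful.
- exact: lexmin_minlen.
- exact: lexmin_minlen.
- by move=> p; rewrite -!mact_cls.
Qed.

Lemma eq_rank f g : (forall p, (f p < f p.+1) = (g p < g p.+1)) -> rank f = rank g.
Proof. by move=> e; apply: eq_bigr => p _; rewrite e. Qed.

(** The block numbers of [g] rise along [f] by [rank g] in a period, and they
    rise at each jump of the composite. *)
Lemma rank_comp f g : cyclic f -> cyclic g -> rank (fun p => g (f p)) <= rank g.
Proof.
move=> cf cg; have [[fm fD _] [gm _ _]] := (cf, cg).
pose A p := jumps g (f p).
have Am : {homo A : p q / p <= q} by move=> p q /fm; apply: jumps_le.
have := @jumps_slow (fun p => g (f p)) A n Am.
rewrite {4}/A -[n in f n]add0n fD jumpsD // addnC leq_add2l; apply=> p.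
by rewrite /A jumps_lt.
Qed.

(** The first condition says that the points of the image of [f] are right
    ends of different blocks of [s], the second that [s] only takes right ends
    of blocks of [g] as values. *)
Definition connects f g s : Prop :=
  (forall x q, s x <= s (f q) -> x <= f q) /\
  (forall q, g (s q) < g (s q).+1).

Lemma connects_lt_l f g s p q : connects f g s ->
  f p < f q -> s (f p) < s (f q).
Proof. by case=> c _; rewrite ltnNge (ltnNge (s _)); apply: contra; apply: c. Qed.

Lemma connects_lt_r f g s p q : {homo g : p q / p <= q} -> connects f g s ->
  s p < s q -> g (s p) < g (s q).
Proof. by move=> gm [_ c] lt; apply: leq_trans (c p) (gm _ _ lt). Qed.

Lemma homo_jump f g p : {homo g : p q / p <= q} -> cyclic f ->
  g (f p) < g (f p.+1) -> f p < f p.+1.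
Proof.
move=> gm [fm _ _]; rewrite [f p < _]ltn_neqAle fm // andbT.
by apply: contraTneq => ->; rewrite ltnn.
Qed.

Lemma connects_rank_product f g s : cyclic f -> cyclic g -> cyclic s ->
  connects f g s -> rank (fun p => g (s (f p))) = rank f.
Proof.
move=> cf cg cs c; have [[gm _ _] [sm _ _]] := (cg, cs).
apply: eq_rank => p; apply/idP/idP.
  by apply: (@homo_jump f (fun p => g (s p))) => // a b /sm/gm.
by move=> /(connects_lt_l c); apply: connects_lt_r gm c.
Qed.

Lemma connects_rank_left f g s : cyclic f -> cyclic s ->
  connects f g s -> rank (fun p => s (f p)) = rank f.
Proof.
move=> cf cs c; have [sm _ _] := cs; apply: eq_rank => p.
by apply/idP/idP; [apply: homo_jump | apply: connects_lt_l c].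
Qed.

(** The composite with [f] bounds the rank of [s] from below, the one with [g]
    from above. *)
Lemma connects_rank f g s : cyclic f -> cyclic g -> cyclic s ->
  rank f = rank g -> connects f g s -> rank s = rank f.
Proof.
move=> cf cg cs e c; apply/eqP; rewrite eqn_leq; apply/andP; split.
  rewrite e; apply: leq_trans (rank_comp cs cg).
  apply: leq_sum => p _; have [gm _ _] := cg.
  have := @connects_lt_r f g s p p.+1 gm c; do 2![case: (_ < _)] => //.
  by move=> /(_ isT).
by rewrite -(connects_rank_left cf cs c); apply: rank_comp.
Qed.

Lemma connecting_element x y N : rank (mact x) = rank (mact y) ->
  rank (mact x) < n ->
  exists2 z, N <= mact z 0 & connects (mact x) (mact y) (mact z).
Proof.
move=> exy lt_n.
have [w [w0 w1 w2]] := connecting_word N (mact_cyclic x) (mact_cyclic y) exy lt_n.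
exists (cls w); first by rewrite mact_cls.
by split=> [a q|q]; rewrite !mact_cls; [apply: w1 | apply: w2].
Qed.

(** ** Cancellation around a connecting element *)

Definition weight f : nat := \sum_(p < n) f p.

Lemma weight_lt f g p : (forall p, f p <= g p) -> p < n -> f p < g p ->
  weight f < weight g.
Proof.
move=> le pn lt; rewrite /weight (bigD1 (Ordinal pn)) //=.
rewrite [X in _ < X](bigD1 (Ordinal pn)) //= -addSn.
by apply: leq_add => //; apply: leq_sum.
Qed.

Lemma weight_eq f g : cyclic f -> cyclic g -> (forall p, f p <= g p) ->
  weight g <= weight f -> f =1 g.
Proof.
move=> cf cg le wle; apply: cyclic_ext => // p pn; apply/eqP.
rewrite eqn_leq le leqNgt; apply/negP => /(weight_lt le pn).
by rewrite ltnNge wle.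
Qed.

(** The numbers of the blocks of [g0] reached by [s (f p)] and by [s (f0 p)]
    both rise exactly at the jumps of the common product, hence differ by a
    constant. If it is negative, [f] lies strictly below [f0], against the
    choice of [f0]. Otherwise [g] lies below [g0] on the image of [s], hence
    everywhere because this image has the right ends of all blocks of [g0], up
    to periods; then [g = g0] by the choice of [g0], the constant is zero, and
    [f] lies below [f0]. *)
Lemma connected_cancel f f0 s g g0 :
    cyclic f -> cyclic f0 -> cyclic s -> cyclic g -> cyclic g0 ->
    rank f0 = rank g0 -> connects f0 g0 s ->
    weight f0 <= weight f -> weight g0 <= weight g ->
    (forall p, g (s (f p)) = g0 (s (f0 p))) ->
  f =1 f0 /\ g =1 g0.
Proof.
move=> cf cf0 cs cg cg0 erk c wf wg e.
have [[fm fD _] [f0m _ _] [sm sD _]] := And3 cf cf0 cs.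
have [[gm gD _] [g0m g0D _]] := (cg, cg0).
pose h p := g0 (s (f0 p)).
have ch : cyclic h by apply: (cyclic_comp (cyclic_comp cf0 cs) cg0).
have rk_h : jumps h n = jumps g0 n.
  by rewrite -[LHS]/(rank h) (connects_rank_product cf0 cg0 cs c).
have s_lt p q : s p < s q -> g0 (s p) < g0 (s q) by apply: connects_lt_r g0m c.
pose idx p := jumps g0 (s p).
have idx_lt p q : (idx p < idx q) = (s p < s q).
  rewrite /idx (jumps_lt _ _ g0m); apply/idP/idP => [|/s_lt//].
  by rewrite ltnNge (ltnNge (s p)); apply: contra; apply: g0m.
have index k k' p : cyclic k -> {homo k' : a b / a <= b} ->
    (forall p, k' (s (k p)) = h p) -> idx (k p) = idx (k 0) + jumps h p.
  move=> ck k'm hE; have [km kD _] := ck; apply: (@jumps_index h (idx \o k)) => //=.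
  - by move=> a b /km/sm; apply: jumps_le.
  - by move=> a; rewrite /idx kD sD jumpsD // rk_h.
  - move=> a; rewrite -!hE idx_lt.
    exact: (homo_jump k'm (cyclic_comp ck cs)).
have idxf p := index f g p cf gm e.
have idxf0 p := index f0 g0 p cf0 g0m (fun=> erefl).
have wgE : (forall p, g p <= g0 p) -> g =1 g0 by move=> le; apply: weight_eq.
case: (ltnP (idx (f 0)) (idx (f0 0))) => [lt|ge].
  have lt_f p : f p < f0 p.
    have : s (f p) < s (f0 p) by rewrite -idx_lt idxf idxf0 ltn_add2r.
    by rewrite ltnNge (ltnNge (f p)); apply: contra; apply: sm.
  have := weight_lt (fun p => ltnW (lt_f p)) n_gt0 (lt_f 0).
  by rewrite ltnNge wf.
have le_s p : s (f0 p) <= s (f p).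
  by rewrite leqNgt -idx_lt idxf idxf0 ltn_add2r -leqNgt.
(* The point [s (f q)] is the right end of its block of [g0], and every block
   of [g0] contains such a point up to a period. *)
have le_g p : g p <= g0 p.
  pose M := idx (f 0); pose P := p + M * n.
  have [q qP] : exists q, idx (f q) = jumps g0 P.
    have le_M : M <= jumps g0 P.
      have := jumps_le g0 (leq_addl p (M * n)).
      have := jumpsDM M 0 cg0; rewrite jumps0 !add0n => ->.
      by apply: leq_trans; rewrite leq_pmulr // jumps_gt0.
    have [q _ qJ] := jump_at (jumps g0 P - M) ch.
    by exists q; rewrite idxf qJ subnKC.
  have e0 : g0 (s (f q)) = g0 P.
    case: (ltngtP (g0 (s (f q))) (g0 P)) => //;
      by rewrite -jumps_lt // -/(idx _) qP ltnn.
  have le_P : P <= s (f q).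
    rewrite leqNgt; apply/negP => /g0m; rewrite -e0 leqNgt.
    by case: c => _ /(_ (f q)) ->.
  have : g P <= g0 P.
    apply: leq_trans (gm _ _ le_P) _; rewrite e -e0; exact: g0m.
  by rewrite !cyclicDM // leq_add2r.
have eg := wgE le_g; split=> //; apply: weight_eq => // p; case: c => c _; apply: c.
by rewrite leqNgt; apply/negP => /s_lt; rewrite -e eg ltnn.
Qed.

(** * Membership in [Mtilde] and in [Iset] *)

Section MembershipByRank.
Variable t : nat.
Hypothesis t_lt : t.+1 < n.

Lemma Mtilde_rank x : Mtilde t x -> rank (mact x) = n - t.+1.
Proof.
move=> /asboolP[w rw inf_w].
have xw := minlen_exclusion (lexmin_minlen (reduced_lexmin rw)).
case: rw => <- _; rewrite -(rank_infix t_lt xw inf_w).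
by apply: eq_rank => p; rewrite !mact_cls.
Qed.

(** The reduced form is the greedy word, to which [lexmin_infix] applies. *)
Lemma Mtilde_large x : rank (mact x) = n - t.+1 -> 3 * n <= mact x 0 ->
  Mtilde t x.
Proof.
move=> rk_x large; have [w rw] := reduced_form_ex x.
apply/asboolP; exists w => //.
have mw := reduced_lexmin rw; case: rw => e _; rewrite -e mact_cls in large.
apply: (lexmin_infix t_lt mw) => //.
by rewrite -rk_x -e; apply: eq_rank => p; rewrite !mact_cls.
Qed.

Lemma act_gt w p : (exists2 i, i \in w & p %% n = i) -> p < act w p.
Proof.
elim: w p => [|j w IH] p [i]; first by rewrite in_nil.
rewrite inE /act /= -/(act w _) /act1 => iw pi.
have [_ _ inf] := act_cyclic w; case: eqP => [_|pj]; first exact: inf.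
apply: IH; exists i => //; case/orP: iw => // /eqP ij.
by rewrite pi ij in pj.
Qed.

Lemma gen_power_gt k p : p + k <= mact (gen n t ^+ k)%g p.
Proof.
elim: k p => [|k IH] p.
  by have [_ _ inf] := mact_cyclic (gen n t ^+ 0)%g; rewrite addn0 inf.
rewrite expgSr mactM mact_cls addnS; apply: leq_ltn_trans (IH p) _.
apply: act_gt; exists (Ordinal (ltn_pmod (mact (gen n t ^+ k)%g p) n_gt0)) => //.
exact: mem_xq.
Qed.

(** An element [x] of this rank divides a power of [gen]. Connect [gen] to [x]
    by some [s]; the product [gen s x] has the same blocks as [gen] because no
    rank is lost, so it divides on the left every power of [gen] that lies
    above it. *)
Lemma rank_notin_Iset x : rank (mact x) = n - t.+1 -> ~ Iset t x.
Proof.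
move=> rk_x Ix.
have rk_gen : rank (mact (gen n t)) = n - t.+1.
  by rewrite -(rank_xq t_lt); apply: eq_rank => p; rewrite !mact_cls.
have exg : rank (mact (gen n t)) = rank (mact x) by rewrite rk_gen.
have [|s _ c] := connecting_element 0 exg; first by rewrite rk_gen; lia.
set y := (gen n t * s * x)%g.
have yE p : mact y p = mact x (mact s (mact (gen n t) p)) by rewrite !mactM.
have rk_y : rank (mact y) = n - t.+1.
  rewrite -rk_gen -(connects_rank_product _ _ _ c) //; try exact: mact_cyclic.
  by apply: eq_rank => p; rewrite !yE.
(* A word of length [m] moves no token by more than [m] steps. *)
pose k := (size (crep y)).+1.
have [||p|w [w_div _]] := @right_divisor (mact y) (mact (gen n t ^+ k)%g)
    (mact_cyclic y) (mact_cyclic _).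
- apply: nonjump; first by rewrite -/(rank _) rk_y; lia.
  by case: (mact_cyclic y).
- move=> p; apply: leq_trans (act_le_size _ _) _.
  apply: leq_trans (gen_power_gt k p).
  by rewrite leq_add2l.
- move=> e; rewrite /k expgS !(mactM (gen n t)); congr (mact _ _).
  have [gm _ _] := mact_cyclic (gen n t); have [xm _ _] := mact_cyclic x.
  apply/eqP; rewrite eqn_leq gm //= leqNgt; apply/negP => /(connects_lt_l c) lt.
  by have := connects_lt_r xm c lt; rewrite -!yE e ltnn.
apply: (Ix (gen n t * s)%g (cls w)); exists k; apply: mact_inj => p.
by rewrite -/y mactM mact_cls w_div.
Qed.

End MembershipByRank.
End CycleMonoid.

(** * Prime contracted algebras *)

Section UniqueTripleProduct.
Variables (K : fieldType) (S : thetaMagmaType).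
Import GRing.Theory.
Implicit Types (a b : {malg K[S]}) (A B : {fset S}).
Local Open Scope ring_scope.

Lemma conv_suml (I : Type) (r : seq I) (F : I -> {malg K[S]}) b :
  conv (\sum_(k <- r) F k) b = \sum_(k <- r) conv (F k) b.
Proof.
elim: r => [|k r IH]; last first.
  by rewrite !big_cons -[F k]scale1r conv_linearl IH !scale1r.
rewrite !big_nil; have := conv_linearl b (- 1) 0 0.
by rewrite scaler0 addr0 scaleN1r addNr.
Qed.

Lemma conv_sumr (I : Type) (r : seq I) (F : I -> {malg K[S]}) b :
  conv b (\sum_(k <- r) F k) = \sum_(k <- r) conv b (F k).
Proof.
elim: r => [|k r IH]; last first.
  by rewrite !big_cons -[F k]scale1r conv_linearr IH !scale1r.
rewrite !big_nil; have := conv_linearr b (- 1) 0 0.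
by rewrite scaler0 addr0 scaleN1r addNr.
Qed.

Lemma conv_triple a b (s : S) :
  conv (conv a << s >>) b =
  \sum_(u <- msupp a) \sum_(v <- msupp b) << a@_u * b@_v *g (u * s * v)%g >>.
Proof.
rewrite {1}[a]monalgE conv_suml conv_suml; apply: eq_bigr => u _.
rewrite convU mulr1 {1}[b]monalgE conv_sumr; apply: eq_bigr => v _.
by rewrite convU.
Qed.

(** A weak form of the unique product property: the middle factor may be
    chosen to suit both sets. *)
Definition unique_triple A B : Prop := exists u s v : S,
  [/\ u \in A, v \in B, (u * s * v)%g != theta &
      forall u' v', u' \in A -> v' \in B -> (u' * s * v' = u * s * v)%g ->
        u' = u /\ v' = v].

Lemma cproj0 : cproj (0 : {malg K[S]}) = 0.
Proof. by apply: (addIr (cproj 0)); rewrite -cprojD !add0r. Qed.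

Lemma cproj_neq0 a : cproj a != 0 -> exists2 u, u \in msupp a & u != theta.
Proof.
move=> a0; apply: contrapT => nex; move: a0; rewrite -cproj0 => /negP; apply.
apply/cprojP; exists (a@_theta); apply/malgP => u.
rewrite add0r scale_malgU mulr1 mcoeffU.
case: eqVneq => [<-//|u0] /=; rewrite mulr0n; apply/eqP.
by rewrite mcoeff_eq0; apply/negP => ua; apply: nex; exists u; rewrite // eq_sym.
Qed.

Lemma cproj_neq0_coeff a u : u != theta -> a@_u != 0 -> cproj a != 0.
Proof.
move=> u0; rewrite -cproj0; apply: contraNneq => /eqP/cprojP[c ->].
by rewrite add0r scale_malgU mcoeffU [theta == u]eq_sym (negbTE u0) mulr0n.
Qed.

(** The coefficient at the isolated product is the product of two nonzero
    coefficients of a field. *)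
Lemma unique_triple_prime :
    (forall A B, (exists2 u, u \in A & u != theta) ->
       (exists2 v, v \in B & v != theta) -> unique_triple A B) ->
  prime_algebra (@cmul K S).
Proof.
move=> ut I J [_ _ _ Ir] [_ _ Jl _] [x Ix x0] [y Jy y0].
rewrite -[x]creprK in x0; rewrite -[y]creprK in y0.
have [u [s [v [uA vB usv uniq_uv]]]] := ut _ _ (cproj_neq0 x0) (cproj_neq0 y0).
pose xs := cmul x (cproj << s >>).
exists (cmul xs y); first exists [:: (xs, y)].
- by move=> p; rewrite inE => /eqP-> /=; split=> //; apply: Ir.
- by rewrite big_seq1.
rewrite /xs -[x]creprK -[y]creprK !cmulE.
apply: (cproj_neq0_coeff usv); rewrite conv_triple.
set a := crepr x in uA uniq_uv *; set b := crepr y in vB uniq_uv *.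
rewrite raddf_sum (big_fsetD1 u uA) /= raddf_sum (big_fsetD1 v vB) /=.
rewrite mcoeffUU !big1_seq ?addr0; last 2 first.
- move=> u' /=; rewrite in_fsetD1 => /andP[u'u u'A].
  rewrite raddf_sum big1_seq // => v' /andP[_ v'B] /=.
  rewrite mcoeffU; case: eqP => [e|_]; last by rewrite mulr0n.
  by case: (uniq_uv _ _ u'A v'B e) => /eqP; rewrite (negbTE u'u).
- move=> v' /=; rewrite in_fsetD1 => /andP[v'v v'B].
  rewrite mcoeffU; case: eqP => [e|_]; last by rewrite mulr0n.
  by case: (uniq_uv _ _ uA v'B e) => _ /eqP; rewrite (negbTE v'v).
by rewrite mulf_neq0 // mcoeff_neq0.
Qed.

End UniqueTripleProduct.

(** * The semigroup [Mt] *)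

Section MtProducts.
Variables n t : nat.
Hypotheses (n_gt2 : 2 < n) (t_lt : t.+1 < n).
Implicit Types x y z : Mt n t.

Lemma Mt_mul_large (u v : {x : Cmon n | Mtilde t x}) :
    rank n (mact (val u * val v)%g) = n - t.+1 ->
    3 * n <= mact (val u * val v)%g 0 ->
  exists2 w, ((Some u : Mt n t) * (Some v : Mt n t))%g = Some w
           & val w = (val u * val v)%g.
Proof.
move=> rk large; have m := Mtilde_large n_gt2 t_lt rk large.
exists (Sub _ m) => //.
rewrite -[LHS]/(Mt_mul (Some u) (Some v)) /Mt_mul ifF ?insubT //.
by apply/asboolP; apply: rank_notin_Iset.
Qed.

Lemma Mt_mul_val x y w : (x * y)%g = Some w ->
  exists u v, [/\ x = Some u, y = Some v & val w = (val u * val v)%g].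
Proof.
case: x y => [u|] [v|] //; rewrite -[LHS]/(Mt_mul (Some u) (Some v)) /Mt_mul.
case: asboolP => // _; case: insubP => // w' _ e [<-].
by exists u, v; split.
Qed.

Lemma least_weight (A : {fset Mt n t}) : (exists2 x, x \in A & x != theta) ->
  exists2 u, Some u \in A &
    forall v, Some v \in A -> weight n (mact (val u)) <= weight n (mact (val v)).
Proof.
move=> [x xA x0].
pose P m := `[< exists2 u, Some u \in A & weight n (mact (val u)) = m >].
have exP : exists m, P m.
  case: x xA x0 => [u|] // uA _; exists (weight n (mact (val u))).
  by apply/asboolP; exists u.
case: (ex_minnP exP) => m /asboolP[u uA <-] min_m.
by exists u => // v vA; apply: min_m; apply/asboolP; exists v.
Qed.

(** The multiplication of [Mt] is the one of the monoid along the chosen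
    factors, since their products are large and of full rank. *)
Lemma Mt_unique_triple (A B : {fset Mt n t}) :
  (exists2 x, x \in A & x != theta) -> (exists2 y, y \in B & y != theta) ->
  unique_triple A B.
Proof.
move=> /least_weight[f0 f0A min_f0] /least_weight[g0 g0B min_g0].
have rk (u : {x : Cmon n | Mtilde t x}) : rank n (mact (val u)) = n - t.+1.
  exact: Mtilde_rank (valP u).
have cyc (x : Cmon n) := mact_cyclic n_gt2 x.
have erk : rank n (mact (val f0)) = rank n (mact (val g0)) by rewrite !rk.
have [|s s_large c] := connecting_element n_gt2 (3 * n) erk.
  by rewrite rk; lia.
have rk_s : rank n (mact s) = n - t.+1.
  by rewrite (connects_rank n_gt2 (cyc _) (cyc _) (cyc _) erk c).
have s_in := Mtilde_large n_gt2 t_lt rk_s s_large.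
pose s1 : {x : Cmon n | Mtilde t x} := exist _ s s_in.
have [sm _ _] := cyc s.
have large_fs : 3 * n <= mact (val f0 * s)%g 0.
  by rewrite mactM //; apply: leq_trans s_large (sm _ _ (leq0n _)).
have [|w1 e1 v1] := @Mt_mul_large f0 s1 _ large_fs.
  rewrite -(rk f0) -(connects_rank_left (cyc _) (cyc _) c).
  by apply: eq_rank => p; rewrite !mactM.
have large_fsg : 3 * n <= mact (val w1 * val g0)%g 0.
  rewrite mactM // v1; have [_ _ gi] := cyc (val g0).
  exact: leq_trans large_fs (gi _).
have [|w2 e2 v2] := @Mt_mul_large w1 g0 _ large_fsg.
  rewrite -(rk f0) -(connects_rank_product (cyc _) (cyc _) (cyc _) c).
  by apply: eq_rank => p; rewrite mactM // v1 !mactM.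
exists (Some f0), (Some s1), (Some g0); split=> //.
  by rewrite e1 e2.
move=> x y xA yB; rewrite e1 e2 => /Mt_mul_val[w3 [g [e3 eg ew]]].
have [f [s2 [ef es ew3]]] := Mt_mul_val e3; case: es => es; subst x y s2.
move: xA yB => fA gB.
have [|||eqf eqg] := @connected_cancel n n_gt2 (mact (val f)) (mact (val f0))
  (mact (val s1)) (mact (val g)) (mact (val g0))
  (cyc _) (cyc _) (cyc _) (cyc _) (cyc _) erk c.
- exact: min_f0.
- exact: min_g0.
- have e : (val f * val s1 * val g)%g = (val f0 * val s1 * val g0)%g.
    by rewrite -ew3 -ew v2 v1.
  by move=> p; have := congr1 (fun x : Cmon n => mact x p) e; rewrite !mactM.
by split; congr Some; apply/val_inj/(mact_inj n_gt2).
Qed.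

End MtProducts.

Theorem theorem5p8 (n : nat) (K : fieldType) (t : nat) :
  (3 <= n)%N -> (t <= n - 2)%N -> prime_algebra (@cmul K (Mt n t)).
Proof.
move=> n_gt2 t_le; apply: unique_triple_prime => A B.
by apply: Mt_unique_triple => //; lia.
Qed.
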